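(* Suppose the averaging oracle $\hat A$ is a submodular set function and has the property that with $\ge r$ simulations, with probability at least $1-\delta$, it provides a uniform $\epsilon$-approximation of $I^\tau$ for all subsets of size at most $s$. Then, with $$2\max\{r,r(\epsilon,\delta)\}+O\Big(\epsilon^{-2}c\big(\ln\tfrac1\delta+\ln(\ln\ln\tfrac n\delta+\ln n)\big)\Big)$$ i.i.d. simulations one can find in polynomial time a $\big(1-(1-1/s)^s\big)(1-5\epsilon)$-approximate solution with confidence $1-5\delta$; that is, a set $T$ with $|T|\le s$ such that $\Pr\big[I^\tau(T)\ge(1-(1-1/s)^s)(1-5\epsilon)\,\mathrm{OPT}^\tau_s\big]\ge1-5\delta$.
   Context: $V$ is a finite set, $|V|=n$. A stochastic diffusion model (SDM) $\mathcal{G}(V,H)$ is a distribution over families $\phi=(\phi_v)_{v\in V}$ of monotone non-decreasing functions $\phi_v:2^{V\setminus\{v\}}\to\{0,1\}$, with a utility $H:2^V\to\mathbb{R}_{\ge0}$, monotone non-decreasing, $H(\emptyset)=0$. A simulation is a draw $\phi\sim\mathcal{G}$. $\mathrm{Reach}^0(\phi,S)=S$, $\mathrm{Reach}^{t+1}(\phi,S)=\mathrm{Reach}^t(\phi,S)\cup\{v\notin\mathrm{Reach}^t(\phi,S):\phi_v(\mathrm{Reach}^t(\phi,S))=1\}$. $R^\tau(S)=H(\mathrm{Reach}^\tau(\phi,S))$, $I^\tau(S)=\mathbb{E}[R^\tau(S)]$, $\mathrm{OPT}^\tau_s=\max_{|S|\le s}I^\tau(S)$. The SDM satisfies, for some $c\ge1$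 and all $T\subset V$, $\operatorname{Var}[R^\tau(T)]\le c\,I^\tau(T)\max\{I^\tau(T),\max_vI^\tau(\{v\})\}$. $\epsilon,\delta\in(0,1)$. The averaging oracle built from i.i.d. simulations $\phi_1,\dots,\phi_\ell$ is the set function $\hat A(T)=\frac1\ell\sum_iH(\mathrm{Reach}^\tau(\phi_i,T))$. A set function $\hat F$ is an $\epsilon$-approximation of $I^\tau$ at $T$ if $|\hat F(T)-I^\tau(T)|\le\epsilon\max\{I^\tau(T),\mathrm{OPT}^\tau_1\}$; uniform for a collection if this holds simultaneously at all its members. $r(\epsilon,\delta)$ is the number of simulations with which the averaging oracle is, for each fixed $T$, an $\epsilon$-approximation at $T$ with probability at least $1-\delta$ (one can take $r(\epsilon,\delta)=\epsilon^{-2}\delta^{-1}c$). The algorithm need not know $r$. $O(\cdot)$ hides absolute constants. *)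

(* Defs.v *)
From HB Require Import structures.
From mathcomp Require Import all_boot all_order all_algebra.
From mathcomp Require Import boolp reals exp.

Set Implicit Arguments.
Unset Strict Implicit.
Unset Printing Implicit Defensive.

Import Order.TTheory GRing.Theory Num.Theory.
Local Open Scope ring_scope.

(** * Stochastic diffusion models *)

(* A family (phi_v)_v of functions on the subsets of V \ {v}.  The functions
   are total on {set V}; the value of phi v at a set containing v is never
   looked at, neither by the model nor by an algorithm. *)
Notation simulation V := {ffun V -> {ffun {set V} -> bool}}.

Definition monotone_family (V : finType) (phi : simulation V) :=
  forall (v : V) (S T : {set V}),
    v \notin T -> S \subset T -> phi v S -> phi v T.

(* [simulation V] is finite, so a distribution is a probability mass function. *)
Record sdm (R : realType) (V : finType) := Sdm {
  pmf : simulation V -> R;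
  pmf_ge0 : forall phi, 0 <= pmf phi;
  pmf_sum1 : \sum_phi pmf phi = 1;
  pmf_monotone : forall phi, pmf phi != 0 -> monotone_family phi;
  util : {set V} -> R;
  util_ge0 : forall S, 0 <= util S;
  util_mono : forall S T : {set V}, S \subset T -> util S <= util T;
  util_set0 : util set0 = 0
}.

Fixpoint reach (V : finType) (phi : simulation V) (t : nat) (S : {set V}) :
    {set V} :=
  if t is t'.+1 then
    let U := reach phi t' S in U :|: [set v | (v \notin U) && phi v U]
  else S.

Section Influence.
Variables (R : realType) (V : finType) (G : sdm R V) (tau : nat).
Implicit Types (S T : {set V}) (s l : nat).

Definition reward (phi : simulation V) T : R := util G (reach phi tau T).

Definition influence T : R := \sum_phi pmf G phi * reward phi T.

Definition reward_variance T : R :=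
  \sum_phi pmf G phi * (reward phi T - influence T) ^+ 2.

(* The default value 0 of the maximum is harmless, as influence is >= 0. *)
Definition opt s : R :=
  \big[Num.max/0]_(T : {set V} | (#|T| <= s)%N) influence T.

Definition variance_bounded (c : R) :=
  forall T, reward_variance T <=
    c * influence T *
    Num.max (influence T) (\big[Num.max/0]_(v : V) influence [set v]).

Definition avg_oracle (w : seq (simulation V)) T : R :=
  (size w)%:R^-1 * \sum_(phi <- w) reward phi T.

Definition approx_at (eps : R) (F : {set V} -> R) T :=
  `|F T - influence T| <= eps * Num.max (influence T) (opt 1).

Definition uniform_approx (eps : R) s (F : {set V} -> R) :=
  forall T, (#|T| <= s)%N -> approx_at eps F T.

(* Probability of an event that depends on l i.i.d. simulations. *)
Definition prob l (E : l.-tuple (simulation V) -> Prop) : R :=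
  \sum_(w : l.-tuple (simulation V) | `[< E w >])
    \prod_(i < l) pmf G (tnth w i).

Definition supported l (w : l.-tuple (simulation V)) :=
  forall i, pmf G (tnth w i) != 0.

End Influence.

Definition submodular (R : realType) (V : finType) (F : {set V} -> R) :=
  forall S T : {set V}, F (S :|: T) + F (S :&: T) <= F S + F T.

(** * Model of computation *)

(* Programs for a real RAM.  There are three unbounded memories, holding
   natural numbers, reals and subsets of V, with indirect addressing; a
   program is a closed term, which depends on neither R nor V.  The i-th
   element of V is the i-th entry of [enum V].  Naturals can be added and
   subtracted but not multiplied in one step, and reals cannot be rounded in
   one step, so that no step hides more than polynomial work. *)
Inductive nexp :=
  | NNum of nat
  | NReg of nexp
  | NAdd of nexp & nexp
  | NSub of nexp & nexp.

Inductive rexp :=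
  | RNat of nexp
  | RReg of nexp
  | RAdd of rexp & rexp
  | RSub of rexp & rexp
  | RMul of rexp & rexp
  | RDiv of rexp & rexp.

Inductive bexp :=
  | BNatLe of nexp & nexp
  | BRealLe of rexp & rexp
  | BMem of nexp & nexp
  | BNot of bexp
  | BAnd of bexp & bexp.

Inductive cmd :=
  | Skip
  | SetNat of nexp & nexp
  | SetReal of nexp & rexp
  | SetEmpty of nexp
  | SetCopy of nexp & nexp
  | SetAdd of nexp & nexp          (* add the i-th element of V to a set *)
  | Draw                           (* request one more simulation *)
  | QueryPhi of nexp & nexp & nexp & nexp
  | QueryUtil of nexp & nexp
  | Seq of cmd & cmd
  | If of bexp & cmd & cmd
  | While of bexp & cmd.

Section Machine.
Variables (R : realType) (V : finType).

Record state := State {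
  nreg : nat -> nat;
  rreg : nat -> R;
  sreg : nat -> {set V};
  drawn : nat
}.

Definition set_nreg st x k :=
  State [eta nreg st with x |-> k] (rreg st) (sreg st) (drawn st).
Definition set_rreg st x a :=
  State (nreg st) [eta rreg st with x |-> a] (sreg st) (drawn st).
Definition set_sreg st x X :=
  State (nreg st) (rreg st) [eta sreg st with x |-> X] (drawn st).
Definition incr_drawn st :=
  State (nreg st) (rreg st) (sreg st) (drawn st).+1.

Fixpoint neval (st : state) (e : nexp) : nat :=
  match e with
  | NNum k => k
  | NReg e1 => nreg st (neval st e1)
  | NAdd e1 e2 => (neval st e1 + neval st e2)%N
  | NSub e1 e2 => (neval st e1 - neval st e2)%N
  end.

Fixpoint reval (st : state) (e : rexp) : R :=
  match e with
  | RNat e1 => (neval st e1)%:R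
  | RReg e1 => rreg st (neval st e1)
  | RAdd e1 e2 => reval st e1 + reval st e2
  | RSub e1 e2 => reval st e1 - reval st e2
  | RMul e1 e2 => reval st e1 * reval st e2
  | RDiv e1 e2 => reval st e1 / reval st e2
  end.

Definition elt (i : nat) : option V := onth (enum V) i.

Fixpoint beval (st : state) (b : bexp) : bool :=
  match b with
  | BNatLe e1 e2 => (neval st e1 <= neval st e2)%N
  | BRealLe e1 e2 => reval st e1 <= reval st e2
  | BMem e X =>
      if elt (neval st e) is Some v then v \in sreg st (neval st X) else false
  | BNot b1 => ~~ beval st b1
  | BAnd b1 b2 => beval st b1 && beval st b2
  end.

(* The sequence w contains the simulations that can be drawn, in order; only
   those already drawn can be queried. *)
Definition query_phi (w : seq (simulation V)) (st : state) (i u : nat)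
    (X : {set V}) : bool :=
  if (onth (take (drawn st) w) i, elt u) is (Some phi, Some v)
  then phi v (X :\ v) else false.

(* A configuration is a stack of commands to be executed and a state. *)
Definition config := (seq cmd * state)%type.

(* [Draw] does not progress when all the simulations of w have been drawn. *)
Definition step (H : {set V} -> R) (w : seq (simulation V)) (cf : config) :
    config :=
  let: (stack, st) := cf in
  if stack is c :: k then
    match c with
    | Skip => (k, st)
    | SetNat x e => (k, set_nreg st (neval st x) (neval st e))
    | SetReal x e => (k, set_rreg st (neval st x) (reval st e))
    | SetEmpty X => (k, set_sreg st (neval st X) set0)
    | SetCopy X Y => (k, set_sreg st (neval st X) (sreg st (neval st Y)))
    | SetAdd X e =>
        (k, if elt (neval st e) is Some v
            then set_sreg st (neval st X) (v |: sreg st (neval st X)) else st)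
    | Draw => if (drawn st < size w)%N then (k, incr_drawn st) else cf
    | QueryPhi x i u X =>
        (k, set_nreg st (neval st x)
              (query_phi w st (neval st i) (neval st u)
                 (sreg st (neval st X))))
    | QueryUtil x X =>
        (k, set_rreg st (neval st x) (H (sreg st (neval st X))))
    | Seq c1 c2 => (c1 :: c2 :: k, st)
    | If b c1 c2 => ((if beval st b then c1 else c2) :: k, st)
    | While b c1 => if beval st b then (c1 :: c :: k, st) else (k, st)
    end
  else cf.

(* The input of an algorithm; the unused registers contain 0 or set0. *)
Definition initial (s tau : nat) (c eps delta : R) : state :=
  State (nth 0%N [:: #|V|; s; tau]) (nth 0 [:: c; eps; delta])
        (fun=> set0) 0.

Definition run H w (prog : cmd) (st : state) (time : nat) : config :=
  iter time (step H w) ([:: prog], st).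

Definition halted (cf : config) : bool := nilp cf.1.

(* The next command requests a simulation that is not in w. *)
Definition starved (w : seq (simulation V)) (cf : config) : bool :=
  if cf.1 is Draw :: _ then (size w <= drawn cf.2)%N else false.

Definition output (cf : config) : {set V} := sreg cf.2 0.

End Machine.

(* Main.v *)
Require Import Defs.
From HB Require Import structures.
From mathcomp Require Import all_boot all_order all_algebra.
From mathcomp Require Import boolp reals sequences exp.
From mathcomp Require Import ring lra.

(* The algorithm draws simulations in blocks of length L, the least number with
   (1 - eps^2 / (10 c))^L <= delta.  In round k, the greedy set T for the
   averages over the first k L simulations, with average A at T, is tested on
   the next k L simulations: T is accepted when A <= 0 or when
     delta^k \prod_y (1 + lam y / A) / (1 + lam (1 - 4 eps)) >= 1,
   where y ranges over the new rewards of T and lam = eps / (5 c).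

   If I(T) < (1 - 4 eps) A, the factors have mean less than 1, and by Markov's
   inequality T is accepted with probability at most delta^k.  If the averages
   are uniformly accurate, then I(T) >= (1 - 5 eps / 4) A, and the inverses of
   the factors have mean at most (1 - eps^2 / (10 c))^2 by the bound on the
   variance, so that T is rejected with probability at most delta^k.  The same
   inverses show that the average at an optimal set is at least
   (1 - eps) OPT, except with probability delta^k.  Hence an accepted set is
   good, and round K, the first with K L >= r, accepts.  Since
   (K - 1) L <= r, this takes at most L + 2 K L <= 2 r + 3 L simulations, and the
   failure probabilities add up to at most 5 delta when delta < 1 / 5.
   The cases s >= |V|, eps >= 1 / 5 and delta >= 1 / 5 are trivial. *)

Set Implicit Arguments.
Unset Strict Implicit.
Unset Printing Implicit Defensive.

Import Order.TTheory GRing.Theory Num.Theory.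
Local Open Scope ring_scope.

(** * Weakest preconditions with a time bound *)

Section WeakestPrecondition.
Variables (R : realType) (V : finType) (H : {set V} -> R).
Variables (w : seq (simulation V)) (B : Prop) (z : nat).
Local Notation state := (state R V).

(* Every loop of the algorithm takes at most [y] turns, so that a bound on the
   time can be read off the program. *)
Fixpoint cost (y : nat) (c : cmd) : nat :=
  match c with
  | Seq c1 c2 | If _ c1 c2 => (cost y c1 + cost y c2).+1
  | While _ c1 => (y.+1 * (cost y c1).+1)%N
  | _ => 1%N
  end.

(* [B] is what is known when the program waits for a missing simulation. *)
Definition wp (c : cmd) (st : state) (Q : state -> Prop) : Prop :=
  exists2 t, (t <= cost z c)%N &
    (exists2 st', Q st' & forall k, iter t (step H w) (c :: k, st) = (k, st'))
    \/ (B /\ forall k, starved w (iter t (step H w) (c :: k, st))).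

Lemma wp_step c st st' (Q : state -> Prop) :
  (0 < cost z c)%N -> (forall k, step H w (c :: k, st) = (k, st')) ->
  Q st' -> wp c st Q.
Proof. by move=> c0 E Qst'; exists 1%N => //; left; exists st'. Qed.

Lemma wp_seq c1 c2 st Q :
  wp c1 st (fun st' => wp c2 st' Q) -> wp (Seq c1 c2) st Q.
Proof.
move=> [t1 t1c [[st1 [t2 t2c E2] E1]|[b E1]]]; last first.
  exists t1.+1; first by rewrite /= ltnS (leq_trans t1c)// leq_addr.
  by right; split=> // k; rewrite iterSr; apply: E1.
exists (t2 + t1).+1; first by rewrite /= addnC ltnS leq_add.
case: E2 => [[st2 Qst2 E2]|[b E2]]; [left; exists st2 => //|right; split=> //];
  by move=> k; rewrite iterSr /= iterD E1 E2.
Qed.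

Lemma wp_if b c1 c2 st Q :
  (beval st b -> wp c1 st Q) -> (~~ beval st b -> wp c2 st Q) ->
  wp (If b c1 c2) st Q.
Proof.
move=> h1 h2; have [t tc E] : wp (if beval st b then c1 else c2) st Q.
  by case: ifP => hb; [apply: h1|apply: h2; rewrite hb].
exists t.+1.
  rewrite /= ltnS (leq_trans tc)//; case: ifP => _; first exact: leq_addr.
  exact: leq_addl.
case: E => [[st2 Qst2 E]|[hB E]]; [left; exists st2 => //|right; split=> //];
  by move=> k; rewrite iterSr /= E.
Qed.

(** [Inv] counts the completed turns. As it keeps the count at most [z], it yields termination and
    the time bound together. *)
Lemma wp_while (Inv : nat -> state -> Prop) b c st Q :
  Inv 0%N st ->
  (forall i st', Inv i st' -> (i <= z)%N) ->
  (forall i st', Inv i st' -> beval st' b -> wp c st' (Inv i.+1)) ->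
  (forall i st', Inv i st' -> ~~ beval st' b -> Q st') ->
  wp (While b c) st Q.
Proof.
move=> I0 Iz Ic IQ.
suff P : forall d i st', (z - i <= d)%N -> Inv i st' ->
  exists2 t, (t <= ((z - i).+1 * (cost z c).+1))%N &
    (exists2 st2, Q st2 &
       forall k, iter t (step H w) (While b c :: k, st') = (k, st2))
    \/ (B /\ forall k, starved w (iter t (step H w) (While b c :: k, st'))).
  by have [t ht E] := P z 0%N st (leq_subr _ _) I0; exists t => //; rewrite subn0 in ht.
elim=> [|d IHd] i st' hd Ii; case: (boolP (beval st' b)) => hb; first last.
- exists 1%N; first by rewrite mulSn addSn.
  by left; exists st'; [exact: IQ Ii hb|move=> k /=; rewrite (negbTE hb)].
- have [t tc E] := Ic _ _ Ii hb.
  have hz := Iz _ _ Ii.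
  case: E => [[st2 I2 E]|[hB E]]; last first.
    exists t.+1; first by rewrite mulSn ltn_addr// ltnS.
    by right; split=> // k; rewrite iterSr /= hb; apply: E.
  have hz2 := Iz _ _ I2.
  have [|t2 t2c E2] := IHd i.+1 st2 _ I2; first by rewrite subnS; case: (z - i)%N hd.
  exists (t2 + t).+1.
    rewrite mulSn addSn ltnS addnC leq_add//.
    by rewrite (leq_trans t2c)// leq_mul2r -(subnSK hz2) leqnn orbT.
  case: E2 => [[st3 Q3 E2]|[hB E2]]; [left; exists st3 => //|right; split=> //];
    by move=> k; rewrite iterSr /= hb iterD E E2.
- exists 1%N; first by rewrite mulSn addSn.
  by left; exists st'; [exact: IQ Ii hb|move=> k /=; rewrite (negbTE hb)].
- have [t tc E] := Ic _ _ Ii hb.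
  case: E => [[st2 I2 E]|[hB E]]; last first.
    exists t.+1; first by rewrite mulSn ltn_addr// ltnS.
    by right; split=> // k; rewrite iterSr /= hb; apply: E.
  (* Here [z <= i], so a completed turn would give [i.+1 <= z], a contradiction. *)
  by have := Iz _ _ I2; move: hd; rewrite leqn0 subn_eq0 => h /leq_trans /(_ h); rewrite ltnn.
Qed.

(** Memories are finite lists padded with the default values of [initial], so that register accesses
    are resolved by simplification. *)
Definition St ns rs ss d : state :=
  State (nth 0%N ns) (nth 0 rs) (nth set0 ss) d.

Lemma with_set_nth (T : Type) (x0 : T) s i y :
  ([eta nth x0 s with i |-> y] : nat -> T) = nth x0 (set_nth x0 s i y).
Proof. by apply/funext => j; rewrite nth_set_nth. Qed.

Definition add_elt (i : nat) (X : {set V}) : {set V} :=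
  if elt V i is Some v then v |: X else X.

Section Primitives.
Variables (ns : seq nat) (rs : seq R) (ss : seq {set V}) (d : nat).
Local Notation st := (St ns rs ss d).
Variable Q : state -> Prop.

Lemma wp_skip : Q st -> wp Skip st Q.
Proof. exact: wp_step. Qed.

Lemma wp_setnat x e :
  Q (St (set_nth 0%N ns (neval st x) (neval st e)) rs ss d) ->
  wp (SetNat x e) st Q.
Proof. by apply: wp_step => // k; rewrite /= /set_nreg with_set_nth. Qed.

Lemma wp_setreal x e :
  Q (St ns (set_nth 0 rs (neval st x) (reval st e)) ss d) ->
  wp (SetReal x e) st Q.
Proof. by apply: wp_step => // k; rewrite /= /set_rreg with_set_nth. Qed.

Lemma wp_setempty X :
  Q (St ns rs (set_nth set0 ss (neval st X) set0) d) -> wp (SetEmpty X) st Q.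
Proof. by apply: wp_step => // k; rewrite /= /set_sreg with_set_nth. Qed.

Lemma wp_setcopy X Y :
  Q (St ns rs (set_nth set0 ss (neval st X) (nth set0 ss (neval st Y))) d) ->
  wp (SetCopy X Y) st Q.
Proof. by apply: wp_step => // k; rewrite /= /set_sreg with_set_nth. Qed.

Lemma wp_setadd X e :
  Q (St ns rs (set_nth set0 ss (neval st X)
       (add_elt (neval st e) (nth set0 ss (neval st X)))) d) ->
  wp (SetAdd X e) st Q.
Proof.
apply: wp_step => // k; rewrite /= /add_elt; case: elt => [v|].
  by rewrite /set_sreg with_set_nth.
congr (_, State _ _ _ _); apply/funext => i /=; rewrite nth_set_nth /=.
by case: eqP => [->|].
Qed.

(** With the supply exhausted the configuration is starved after zero steps; what remains is to
    establish [B]. *)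
Lemma wp_draw :
  ((d < size w)%N -> Q (St ns rs ss d.+1)) -> ((size w <= d)%N -> B) ->
  wp Draw st Q.
Proof.
move=> h1 h2; case: (ltnP d (size w)) => hd.
  by apply: (@wp_step _ _ (St ns rs ss d.+1)) => // [k|]; [rewrite /= hd|apply: h1].
by exists 0%N => //; right; split=> //; apply: h2.
Qed.

Lemma wp_queryphi x i u X :
  Q (St (set_nth 0%N ns (neval st x)
       (query_phi w st (neval st i) (neval st u) (nth set0 ss (neval st X))))
       rs ss d) ->
  wp (QueryPhi x i u X) st Q.
Proof. by apply: wp_step => // k; rewrite /= /set_nreg with_set_nth. Qed.

Lemma wp_queryutil x X :
  Q (St ns (set_nth 0 rs (neval st x) (H (nth set0 ss (neval st X)))) ss d) ->
  wp (QueryUtil x X) st Q.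
Proof. by apply: wp_step => // k; rewrite /= /set_rreg with_set_nth. Qed.

End Primitives.
End WeakestPrecondition.

(** A loop raises the exponent by one, and sequencing adds exponents. The base is [y.+1] because
    powers of a positive number grow with the exponent. *)
Lemma cost_poly (c : cmd) :
  exists a b : nat, forall y, (cost y.+1 c <= a * y.+1 ^ b)%N.
Proof.
have base : exists a b : nat, forall y, (1 <= a * y.+1 ^ b)%N.
  by exists 1%N, 0%N => y; rewrite expn0.
have mono a b b' y : (a * y.+1 ^ b <= a * y.+1 ^ (b + b'))%N.
  by rewrite leq_mul2l leq_pexp2l ?orbT ?leq_addr.
have add c1 c2 : 
  (exists a b : nat, forall y, (cost y.+1 c1 <= a * y.+1 ^ b)%N) ->
  (exists a b : nat, forall y, (cost y.+1 c2 <= a * y.+1 ^ b)%N) ->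
  exists a b : nat, forall y, ((cost y.+1 c1 + cost y.+1 c2).+1 <= a * y.+1 ^ b)%N.
  move=> [a1 [b1 h1]] [a2 [b2 h2]]; exists (a1 + a2 + 1)%N, (b1 + b2)%N => y.
  rewrite -addn1 !mulnDl !leq_add// ?mul1n ?expn_gt0//.
    exact: leq_trans (h1 y) (mono _ _ _ _).
  by rewrite addnC; apply: leq_trans (h2 y) (mono _ _ _ _).
elim: c => //= [c1 IH1 c2 IH2|_ c1 IH1 c2 IH2|_ c [a [b h]]]; try exact: add.
exists (2 * (a + 1))%N, (b + 1)%N => y.
rewrite expnD expn1 (mulnC (_ ^ b)%N) mulnACA leq_mul//.
  by rewrite mul2n -addnn addnS ltnS leq_addr.
by rewrite mulnDl mul1n -addn1 leq_add// expn_gt0.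
Qed.

(** * The algorithm *)

Notation "c1 ;; c2" := (Seq c1 c2) (at level 90, right associativity).
Notation num i := (NNum i).
Notation nat_reg i := (NReg (NNum i)).
Notation real_reg i := (RReg (NNum i)).
Notation real_num k := (RNat (NNum k)).
Notation incr i := (SetNat (num i) (NAdd (nat_reg i) (num 1))).
Notation BNatLt e1 e2 := (BNot (BNatLe e2 e1)).

(* Natural registers: 0 |V|, 1 s, 2 tau, 3 L, 4 k * L, 5 greedy step or number
   of draws, 6 candidate, 7 simulation, 8 time, 9 vertex, 10 query, 11 best
   candidate, 12 acceptance flag.
   Real registers: 0 c, 1 eps, 2 delta, 3 rho ^ l, 4 delta ^ k, 5 accumulated
   utility, 6 best utility, 7 utility of a query, 8 estimated influence, 9
   value of the test.
   Set registers: 0 greedy set, 1 set being evaluated, 2 set reached, 3 next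
   set reached. *)

Definition reach_cmd : cmd :=
  SetCopy (num 2) (num 1) ;; SetNat (num 8) (num 0) ;;
  While (BAnd (BNatLt (nat_reg 8) (nat_reg 2)) (BNatLt (nat_reg 8) (nat_reg 0)))
   (SetCopy (num 3) (num 2) ;; SetNat (num 9) (num 0) ;;
    While (BNatLt (nat_reg 9) (nat_reg 0))
     (QueryPhi (num 10) (nat_reg 7) (nat_reg 9) (num 2) ;;
      If (BAnd (BNatLe (num 1) (nat_reg 10)) (BNot (BMem (nat_reg 9) (num 2))))
        (SetAdd (num 3) (nat_reg 9)) Skip ;;
      incr 9) ;;
    SetCopy (num 2) (num 3) ;; incr 8) ;;
  QueryUtil (num 7) (num 2).

Definition sum_cmd : cmd :=
  SetReal (num 5) (real_num 0) ;; SetNat (num 7) (num 0) ;;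
  While (BNatLt (nat_reg 7) (nat_reg 4))
   (reach_cmd ;;
    SetReal (num 5) (RAdd (real_reg 5) (real_reg 7)) ;;
    incr 7).

Definition greedy_cmd : cmd :=
  SetEmpty (num 0) ;; SetNat (num 5) (num 0) ;;
  While (BNatLt (nat_reg 5) (nat_reg 1))
   (SetNat (num 11) (num 0) ;; SetReal (num 6) (real_num 0) ;;
    SetNat (num 6) (num 0) ;;
    While (BNatLt (nat_reg 6) (nat_reg 0))
     (SetCopy (num 1) (num 0) ;; SetAdd (num 1) (nat_reg 6) ;; sum_cmd ;;
      If (BRealLe (real_reg 6) (real_reg 5))
        (SetReal (num 6) (real_reg 5) ;; SetNat (num 11) (nat_reg 6)) Skip ;;
      incr 6) ;;
    SetAdd (num 0) (nat_reg 11) ;; incr 5).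

Definition lambda_exp : rexp := RDiv (real_reg 1) (RMul (real_num 5) (real_reg 0)).

Definition test_cmd : cmd :=
  SetCopy (num 1) (num 0) ;; sum_cmd ;;
  SetReal (num 8) (RDiv (real_reg 5) (RNat (nat_reg 4))) ;;
  SetReal (num 9) (real_num 1) ;; SetNat (num 7) (nat_reg 4) ;;
  While (BNatLt (nat_reg 7) (NAdd (nat_reg 4) (nat_reg 4)))
   (reach_cmd ;;
    SetReal (num 9) (RMul (real_reg 9)
      (RDiv (RAdd (real_num 1) (RMul lambda_exp (RDiv (real_reg 7) (real_reg 8))))
            (RAdd (real_num 1) (RMul lambda_exp
               (RSub (real_num 1) (RMul (real_num 4) (real_reg 1))))))) ;;
    incr 7) ;;
  If (BAnd (BNot (BRealLe (real_reg 8) (real_num 0)))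
           (BNot (BRealLe (real_num 1) (RMul (real_reg 4) (real_reg 9)))))
    Skip (SetNat (num 12) (num 1)).

Definition block_cmd : cmd :=
  SetReal (num 3) (real_num 1) ;; SetReal (num 4) (real_num 1) ;;
  While (BNot (BRealLe (real_reg 3) (real_reg 2)))
   (Draw ;; incr 3 ;;
    SetReal (num 3) (RMul (real_reg 3) (RSub (real_num 1)
      (RDiv (RMul (real_reg 1) (real_reg 1)) (RMul (real_num 10) (real_reg 0)))))).

Definition draw_cmd : cmd :=
  SetNat (num 5) (num 0) ;;
  While (BNatLt (nat_reg 5) (NAdd (nat_reg 3) (nat_reg 3))) (Draw ;; incr 5).

Definition search_cmd : cmd :=
  block_cmd ;;
  While (BNatLe (nat_reg 12) (num 0))
   (SetNat (num 4) (NAdd (nat_reg 4) (nat_reg 3)) ;;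
    SetReal (num 4) (RMul (real_reg 4) (real_reg 2)) ;;
    draw_cmd ;; greedy_cmd ;; test_cmd).

Definition all_cmd : cmd :=
  While (BNatLt (nat_reg 6) (nat_reg 0)) (SetAdd (num 0) (nat_reg 6) ;; incr 6).

Definition main_cmd : cmd :=
  If (BNatLe (nat_reg 0) (nat_reg 1)) all_cmd
   (If (BRealLe (real_num 1) (RMul (real_num 5) (real_reg 1))) Skip search_cmd).

Lemma onth_lt (T : Type) (x0 : T) (r : seq T) i :
  (i < size r)%N -> onth r i = Some (nth x0 r i).
Proof. by move=> hi; rewrite onthE (nth_map x0). Qed.

(** * Stabilisation and monotonicity of the diffusion *)

Section Reach.
Variables (V : finType) (phi : simulation V).
Implicit Types S T : {set V}.

(** Each round either adds a vertex or leaves the set fixed, and a round that adds nothing repeats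
    forever. *)
Lemma reach_stable t S :
  (t <= #|reach phi t S|)%N \/ reach phi t.+1 S = reach phi t S.
Proof.
elim: t => [|t [IH|IH]]; [by left| |by right; rewrite -[LHS]/(reach phi 1 (reach phi t.+1 S)) IH].
have [E|ne] := eqVneq (reach phi t.+1 S) (reach phi t S).
  by right; rewrite -[LHS]/(reach phi 1 (reach phi t.+1 S)) E.
left; apply: leq_ltn_trans IH (proper_card _).
by rewrite properEneq eq_sym ne subsetUl.
Qed.

(** This justifies cutting the diffusion loop of [reach_cmd] at [#|V|] rounds, which keeps its
    running time independent of [tau]. *)
Lemma reach_card t S : (#|V| <= t)%N -> reach phi t S = reach phi #|V| S.
Proof.
have stab m : reach phi m.+1 S = reach phi m S ->
    forall d, reach phi (m + d) S = reach phi m S.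
  move=> E; elim=> [|d IH]; first by rewrite addn0.
  by rewrite addnS /= IH; exact: E.
move=> /subnKC <-; apply: stab; have [h|//] := reach_stable #|V| S.
have E : reach phi #|V| S = setT.
  by apply/eqP; rewrite eqEcard subsetT cardsT.
by rewrite /= E setTU.
Qed.

Lemma reach_mono t S T :
  monotone_family phi -> S \subset T -> reach phi t S \subset reach phi t T.
Proof.
move=> mono ST; elim: t => [//|t IH] /=.
apply/subsetP => v; rewrite !inE => /orP[/(subsetP IH)->//|/andP[_ pv]].
by case: (boolP (v \in reach phi t T)) => //= vT; rewrite (mono v _ _ vT IH).
Qed.

End Reach.

(** * Mathematical specification of what the programs compute *)

Section Specification.
Variables (R : realType) (V : finType) (H : {set V} -> R).
Variables (s tau : nat) (c eps delta : R).
Implicit Types (x : seq (simulation V)) (T : {set V}) (F : {set V} -> R).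

Definition total_util x T : R := \sum_(phi <- x) H (reach phi tau T).

(** Ties go to the later candidate, so for a nonnegative [F] the initial pair [(0, 0)] is replaced
    by the first candidate. *)
Definition better F T (p : nat * R) (u : nat) : nat * R :=
  if p.2 <= F (add_elt u T) then (u, F (add_elt u T)) else p.

Definition best_index F T : nat := (foldl (better F T) (0%N, 0) (iota 0 #|V|)).1.

Definition greedy F (j : nat) : {set V} :=
  iter j (fun T => add_elt (best_index F T) T) set0.

Definition rate : R := eps / (5%:R * c).

(** The return on a bet that the influence exceeds [(1 - 4 eps) A]; [rate] is the [lam] of the
    overview. The case [A <= 0], where the quotient is meaningless, is settled separately in
    [accept]. *)
Definition wager (A y : R) : R :=
  (1 + rate * (y / A)) / (1 + rate * (1 - 4%:R * eps)).

Definition stake (A : R) T x : R :=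
  \prod_(phi <- x) wager A (H (reach phi tau T)).

Definition accept (D A : R) T x : bool :=
  (A <= 0) || (1 <= D * stake A T x).

Definition greedy_set x : {set V} := greedy (total_util x) s.

Definition estimate x T : R := total_util x T / (size x)%:R.

Definition accept_block (D : R) x (y : seq (simulation V)) : bool :=
  accept D (estimate x (greedy_set x)) (greedy_set x) y.

(** Within a round the base and the pool are disjoint, hence independent. Simulations are reused
    across rounds, which is harmless for a union bound. *)
Definition round_ok w L k : bool :=
  accept_block (delta ^+ k) (take (k * L) w) (take (k * L) (drop (k * L) w)).

Definition decay : R := 1 - eps * eps / (10%:R * c).

End Specification.

(** * Correctness of the components of the program *)

Section Programs.
Variables (R : realType) (V : finType) (H : {set V} -> R).
Variables (w : seq (simulation V)) (B : Prop) (z : nat).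
Hypothesis Vz : (#|V| <= z)%N.
Hypothesis wz : (size w <= z)%N.
Variables (s tau : nat) (c eps delta : R).

Local Notation wp := (wp H w B z).

Lemma wp_reach phi L b j v i t u q best flag r0 r1 r2 r3 r4 r5 r6 h r8 r9
    T U X Y d Q :
  onth (take d w) i = Some phi ->
  (forall t' u' q' Y', Q (St
     [:: #|V|; s; tau; L; b; j; v; i; t'; u'; q'; best; flag]
     [:: r0; r1; r2; r3; r4; r5; r6; H (reach phi tau U); r8; r9]
     [:: T; U; reach phi tau U; Y'] d)) ->
  wp reach_cmd
    (St [:: #|V|; s; tau; L; b; j; v; i; t; u; q; best; flag]
     [:: r0; r1; r2; r3; r4; r5; r6; h; r8; r9] [:: T; U; X; Y] d) Q.
Proof.
move=> hi hQ; apply/wp_seq/wp_setcopy/wp_seq/wp_setnat => /=.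
apply: wp_seq.
pose Inv t' (st : state R V) := (t' <= tau)%N /\ (t' <= #|V|)%N /\
  exists u' q' Y', st = St
     [:: #|V|; s; tau; L; b; j; v; i; t'; u'; q'; best; flag]
     [:: r0; r1; r2; r3; r4; r5; r6; h; r8; r9]
     [:: T; U; reach phi t' U; Y'] d.
apply: (@wp_while _ _ _ _ _ _ Inv).
- by do 2 split=> //; exists u, q, Y.
- by move=> t' _ [_ [/leq_trans + _]]; apply.
- move=> t' _ [_ [_ [u' [q' [Y' ->]]]]] /=; rewrite -!ltnNge => /andP[htau hV].
  apply/wp_seq/wp_setcopy/wp_seq/wp_setnat => /=; apply: wp_seq.
  set A := reach phi t' U.
  (* All queries concern the old set [A]; the new set grows in a register of its own, so that the
     vertices are activated simultaneously. *)
  pose Inv2 (u' : nat) (st : state R V) := (u' <= #|V|)%N /\ exists q', st = St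
     [:: #|V|; s; tau; L; b; j; v; i; t'; u'; q'; best; flag]
     [:: r0; r1; r2; r3; r4; r5; r6; h; r8; r9]
     [:: T; U; A;
       A :|: [set x in take u' (enum V) | (x \notin A) && phi x A]] d.
  apply: (@wp_while _ _ _ _ _ _ Inv2).
  + split=> //; exists q'; congr (St _ _ [:: _; _; _; _] _).
    by apply/setP => x; rewrite !inE take0 in_nil orbF.
  + by move=> u2 _ [/leq_trans + _]; apply.
  + move=> u2 _ [_ [q2 ->]] /=; rewrite -ltnNge => hu2.
    have [v0 _] : exists v0 : V, v0 \in V.
      by apply/card_gt0P; exact: leq_ltn_trans hu2.
    have hu2' : (u2 < size (enum V))%N by rewrite -cardE.
    have eltu : elt V u2 = Some (nth v0 (enum V) u2) by rewrite /elt (onth_lt v0).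
    set x := nth v0 (enum V) u2 in eltu.
    apply/wp_seq/wp_queryphi => /=; apply: wp_seq.
    have fin flag2 : (flag2 = query_phi w (St
       [:: #|V|; s; tau; L; b; j; v; i; t'; u2; q2; best; flag]
       [:: r0; r1; r2; r3; r4; r5; r6; h; r8; r9]
       [:: T; U; A; A :|: [set x in take u2 (enum V) | (x \notin A) && phi x A]]
       d) i u2 A) -> flag2 = phi x (A :\ x).
      by move=> ->; rewrite /query_phi /= hi eltu.
    move: fin; set b2 := query_phi _ _ _ _ _ => /(_ _ erefl) ->.
    have expand : A :|: [set x in take u2.+1 (enum V) | (x \notin A) && phi x A]
       = if phi x (A :\ x) && (x \notin A) then
          x |: (A :|: [set x in take u2 (enum V) | (x \notin A) && phi x A])
         else A :|: [set x in take u2 (enum V) | (x \notin A) && phi x A].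
      have E y : (y \in take u2.+1 (enum V)) = (y == x) || (y \in take u2 (enum V)).
        by rewrite (take_nth v0)// mem_rcons inE.
      (* A query deletes [x] from the set. This only matters for [x] in [A], and then the answer is
         ignored. *)
      have AxE : x \notin A -> A :\ x = A.
        by move=> xA; apply/setP => y; rewrite !inE; case: eqP => // ->; rewrite (negbTE xA).
      case: ifPn => [/andP[px xA]|nx]; apply/setP => y; rewrite !inE E.
        rewrite AxE// in px; case: (eqVneq y x) => [->|]//=; by rewrite (negbTE xA) px.
      case: (eqVneq y x) nx => [->|]//=; case: (boolP (x \in A)) => //= xA.
      by rewrite AxE// andbT => /negbTE ->; rewrite andbF.
    apply: wp_if => /=; rewrite eltu lt0b => hb.
      apply/wp_setadd => /=; apply/wp_setnat => /=; split=> //.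
      by exists (phi x (A :\ x)); rewrite expand hb addn1 /add_elt eltu.
    apply/wp_skip => /=; apply/wp_setnat => /=; split=> //.
    by exists (phi x (A :\ x)); rewrite expand (negbTE hb) addn1.
  + move=> u2 _ [hu2 [q2 ->]] /=; rewrite -ltnNge -leqNgt => hu2'.
    apply/wp_seq/wp_setcopy/wp_setnat => /=; do 2 split=> //.
    have -> : A :|: [set x in take u2 (enum V) | (x \notin A) && phi x A] =
              reach phi t'.+1 U.
      rewrite take_oversize -?cardE//= -/A; congr (_ :|: _).
      by apply/setP => y; rewrite !inE mem_enum.
    by rewrite addn1; exists u2, q2, (reach phi t'.+1 U).
- move=> t' _ [h1 [h2 [u' [q' [Y' ->]]]]] /=; rewrite -!ltnNge negb_and -!leqNgt => hex.
  apply/wp_queryutil => /=.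
  suff -> : reach phi t' U = reach phi tau U by apply: hQ.
  (* The loop ended either at [tau] or at [#|V|], after which the diffusion is stationary. *)
  case/orP: hex => hex; first by congr reach; apply/eqP; rewrite eqn_leq h1.
  have -> : t' = #|V| by apply/eqP; rewrite eqn_leq h2.
  by rewrite [RHS]reach_card ?(leq_trans hex h1).
Qed.


(** The offset [j] is 0 when averaging over the base and [b] when reading the pool. *)
Lemma take_onth d i : (i < d)%N -> (d <= size w)%N ->
  exists2 phi, onth (take d w) i = Some phi &
    forall j, (j <= i)%N -> take (i.+1 - j) (drop j w) = rcons (take (i - j) (drop j w)) phi.
Proof.
move=> id dw; have iw := leq_trans id dw.
have [phi0 _] : exists phi0 : simulation V, true by case: w iw => // phi0; exists phi0.
exists (nth phi0 w i).
  by rewrite (onth_lt phi0) ?size_takel// nth_take.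
move=> j ji; rewrite subSn// (take_nth phi0) ?nth_drop ?subnKC//.
by rewrite size_drop ltn_sub2r// (leq_ltn_trans ji).
Qed.

Lemma wp_sum L b j v i t u q best flag r0 r1 r2 r3 r4 r5 r6 h r8 r9
    T U X Y d Q :
  (b <= d)%N -> (d <= size w)%N ->
  (forall i' t' u' q' h' X' Y', Q (St
     [:: #|V|; s; tau; L; b; j; v; i'; t'; u'; q'; best; flag]
     [:: r0; r1; r2; r3; r4; total_util H tau (take b w) U; r6; h'; r8; r9]
     [:: T; U; X'; Y'] d)) ->
  wp sum_cmd
    (St [:: #|V|; s; tau; L; b; j; v; i; t; u; q; best; flag]
     [:: r0; r1; r2; r3; r4; r5; r6; h; r8; r9] [:: T; U; X; Y] d) Q.
Proof.
move=> bd dw hQ; apply/wp_seq/wp_setreal/wp_seq/wp_setnat => /=.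
pose Inv i' (st : state R V) := (i' <= b)%N /\ exists t' u' q' h' X' Y', st = St
     [:: #|V|; s; tau; L; b; j; v; i'; t'; u'; q'; best; flag]
     [:: r0; r1; r2; r3; r4; total_util H tau (take i' w) U; r6; h'; r8; r9]
     [:: T; U; X'; Y'] d.
apply: (@wp_while _ _ _ _ _ _ Inv).
- by split=> //; exists t, u, q, h, X, Y; rewrite /total_util take0 big_nil.
- by move=> i' _ [ib _]; rewrite (leq_trans ib)// (leq_trans bd)// (leq_trans dw).
- move=> i' _ [_ [t' [u' [q' [h' [X' [Y' ->]]]]]]] /=; rewrite -ltnNge => ib.
  have [phi hphi /(_ 0%N isT)] := take_onth (leq_trans ib bd) dw.
  rewrite !subn0 drop0 => hrc.
  apply: wp_seq; apply: wp_reach; first exact: hphi.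
  move=> t2 u2 q2 Y2; apply/wp_seq/wp_setreal/wp_setnat => /=; split=> //.
  rewrite addn1; exists t2, u2, q2; do 3 eexists; congr (St _ _ _ _).
  by rewrite /total_util hrc -cats1 big_cat big_seq1.
- move=> i' _ [ib [t' [u' [q' [h' [X' [Y' ->]]]]]]] /=; rewrite -ltnNge -leqNgt => bi.
  by have -> : i' = b by apply/eqP; rewrite eqn_leq ib.
Qed.

Lemma wp_greedy L b j v i t u q best flag r0 r1 r2 r3 r4 r5 r6 h r8 r9
    T U X Y d Q :
  (b <= d)%N -> (d <= size w)%N -> (s <= z)%N ->
  (forall j' v' i' t' u' q' best' r5' r6' h' U' X' Y', Q (St
     [:: #|V|; s; tau; L; b; j'; v'; i'; t'; u'; q'; best'; flag]
     [:: r0; r1; r2; r3; r4; r5'; r6'; h'; r8; r9]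
     [:: greedy_set H s tau (take b w); U'; X'; Y'] d)) ->
  wp greedy_cmd
    (St [:: #|V|; s; tau; L; b; j; v; i; t; u; q; best; flag]
     [:: r0; r1; r2; r3; r4; r5; r6; h; r8; r9] [:: T; U; X; Y] d) Q.
Proof.
move=> bd dw sz hQ; apply/wp_seq/wp_setempty/wp_seq/wp_setnat => /=.
set F := total_util H tau (take b w).
pose Inv j' (st : state R V) := (j' <= s)%N /\ exists v' i' t' u' q' best' r5' r6' h' U' X' Y', st = St
     [:: #|V|; s; tau; L; b; j'; v'; i'; t'; u'; q'; best'; flag]
     [:: r0; r1; r2; r3; r4; r5'; r6'; h'; r8; r9]
     [:: greedy F j'; U'; X'; Y'] d.
apply: (@wp_while _ _ _ _ _ _ Inv).
- by split=> //; exists v, i, t, u, q, best, r5, r6, h, U, X, Y.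
- by move=> j' _ [js _]; rewrite (leq_trans js).
- move=> j' _ [_ [v' [i' [t' [u' [q' [best' [r5' [r6' [h' [U' [X' [Y' ->]]]]]]]]]]]]] /=.
  rewrite -ltnNge => js.
  apply/wp_seq/wp_setnat/wp_seq/wp_setreal/wp_seq/wp_setnat/wp_seq => /=.
  set S := greedy F j'.
  pose Inv2 v' (st : state R V) := (v' <= #|V|)%N /\ exists i' t' u' q' r5' h' U' X' Y',
    let p := foldl (better F S) (0%N, 0) (iota 0 v') in st = St
     [:: #|V|; s; tau; L; b; j'; v'; i'; t'; u'; q'; p.1; flag]
     [:: r0; r1; r2; r3; r4; r5'; p.2; h'; r8; r9]
     [:: S; U'; X'; Y'] d.
  apply: (@wp_while _ _ _ _ _ _ Inv2).
  + by split=> //; exists i', t', u', q', r5', h', U', X', Y'.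
  + by move=> v2 _ [vV _]; rewrite (leq_trans vV).
  + move=> v2 _ [_ [i2 [t2 [u2 [q2 [r52 [h2 [U2 [X2 [Y2 ->]]]]]]]]]] /=.
    rewrite -ltnNge => vV.
    apply/wp_seq/wp_setcopy/wp_seq/wp_setadd/wp_seq => /=.
    apply: wp_sum => // i3 t3 u3 q3 h3 X3 Y3; apply: wp_seq.
    set p := foldl _ _ _.
    have pE : foldl (better F S) (0%N, 0) (iota 0 v2.+1) = better F S p v2.
      by rewrite -addn1 iotaD foldl_cat.
    apply: wp_if => /= hb.
      apply/wp_seq/wp_setreal/wp_setnat/wp_setnat => /=; split=> //.
      by rewrite pE /better hb addn1; do 9 eexists.
    apply/wp_skip/wp_setnat => /=; split=> //.
    by rewrite pE /better (negbTE hb) addn1; do 9 eexists.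
  + move=> v2 _ [h2V [i2 [t2 [u2 [q2 [r52 [h2 [U2 [X2 [Y2 ->]]]]]]]]]] /=.
    rewrite -ltnNge -leqNgt => Vv.
    have -> : v2 = #|V| by apply/eqP; rewrite eqn_leq h2V.
    apply/wp_seq/wp_setadd/wp_setnat => /=; split=> //.
    by rewrite addn1; do 12 eexists.
- move=> j' _ [js [v' [i' [t' [u' [q' [best' [r5' [r6' [h' [U' [X' [Y' ->]]]]]]]]]]]]] /=.
  rewrite -ltnNge -leqNgt => sj.
  by have -> : j' = s by apply/eqP; rewrite eqn_leq js.
Qed.

Lemma wp_test L b j v i t u q best flag r2 r3 r4 r5 r6 h r8 r9
    T U X Y d Q :
  (b + b <= d)%N -> (d <= size w)%N ->
  (forall i' t' u' q' r5' h' r8' r9' U' X' Y', Q (St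
     [:: #|V|; s; tau; L; b; j; v; i'; t'; u'; q'; best;
        if accept H tau c eps r4 (estimate H tau (take b w) T) T
            (take b (drop b w)) then 1%N else flag]
     [:: c; eps; r2; r3; r4; r5'; r6; h'; r8'; r9']
     [:: T; U'; X'; Y'] d)) ->
  wp test_cmd
    (St [:: #|V|; s; tau; L; b; j; v; i; t; u; q; best; flag]
     [:: c; eps; r2; r3; r4; r5; r6; h; r8; r9] [:: T; U; X; Y] d) Q.
Proof.
move=> bbd dw hQ; apply/wp_seq/wp_setcopy/wp_seq => /=.
have bd : (b <= d)%N by rewrite (leq_trans _ bbd)// leq_addr.
apply: wp_sum => // i1 t1 u1 q1 h1 X1 Y1.
apply/wp_seq/wp_setreal/wp_seq/wp_setreal/wp_seq/wp_setnat => /=.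
have -> : total_util H tau (take b w) T / b%:R = estimate H tau (take b w) T.
  by rewrite /estimate size_takel// (leq_trans bd).
set A := estimate H tau (take b w) T.
apply: wp_seq.
(* The simulation register holds [b + k], as the pool starts right after the [b] simulations of the
   base. *)
pose Inv k (st : state R V) := (k <= b)%N /\ exists t' u' q' r5' h' X' Y', st = St
     [:: #|V|; s; tau; L; b; j; v; (b + k)%N; t'; u'; q'; best; flag]
     [:: c; eps; r2; r3; r4; r5'; r6; h'; A; stake H tau c eps A T (take k (drop b w))]
     [:: T; T; X'; Y'] d.
apply: (@wp_while _ _ _ _ _ _ Inv).
- split=> //; do 7 eexists; rewrite addn0 /stake take0 big_nil; reflexivity.
- by move=> k _ [kb _]; rewrite (leq_trans kb)// (leq_trans bd)// (leq_trans dw).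
- move=> k _ [_ [t2 [u2 [q2 [r52 [h2 [X2 [Y2 ->]]]]]]]] /=.
  rewrite -ltnNge ltn_add2l => kb.
  have kd : (b + k < d)%N by rewrite (leq_trans _ bbd)// ltn_add2l.
  have [phi hphi /(_ b (leq_addr _ _))] := take_onth kd dw.
  rewrite -addnS !addKn => hrc.
  apply: wp_seq; apply: wp_reach; first exact: hphi.
  move=> t3 u3 q3 Y3; apply/wp_seq/wp_setreal/wp_setnat => /=; split=> //.
  rewrite addn1 addnS; do 7 eexists; congr (St _ _ _ _).
  by rewrite /stake hrc -cats1 big_cat big_seq1.
- move=> k _ [kb [t2 [u2 [q2 [r52 [h2 [X2 [Y2 ->]]]]]]]] /=.
  rewrite -ltnNge -leqNgt leq_add2l => bk.
  have {bk kb} -> : k = b by apply/eqP; rewrite eqn_leq kb.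
  apply: wp_if => /=; rewrite -negb_or => hb.
    apply: wp_skip.
    have := hQ (b + b)%N t2 u2 q2 r52 h2 A (stake H tau c eps A T (take b (drop b w))) T X2 Y2.
    by rewrite /accept (negbTE hb).
  apply/wp_setnat => /=.
  have := hQ (b + b)%N t2 u2 q2 r52 h2 A (stake H tau c eps A T (take b (drop b w))) T X2 Y2.
  by rewrite /accept; rewrite negbK in hb; rewrite hb.
Qed.

End Programs.

(** * Correctness of the search and the number of its draws *)

Section Search.
Variables (R : realType) (V : finType) (H : {set V} -> R).
Variables (w : seq (simulation V)) (B : Prop) (z : nat).
Hypothesis Vz : (#|V| <= z)%N.
Hypothesis wz : (size w <= z)%N.
Variables (s tau : nat) (c eps delta : R).
Variable L : nat.
Hypothesis L_gt0 : (0 < L)%N.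
Hypothesis decayL : decay c eps ^+ L <= delta.
Hypothesis L_min : forall l, (l < L)%N -> delta < decay c eps ^+ l.

Local Notation wp := (wp H w B z).
Local Notation ok k := (round_ok H s tau c eps delta w L k).

(** Up to round [k] the search draws [(2 k + 1) L] simulations: [L] while determining [L], then
    [2 L] in each round. The value [k = 0] stands for that first phase. *)
Hypothesis stuck : forall k, (size w < (k.*2.+1) * L)%N ->
  (forall k', (0 < k' < k)%N -> ~~ ok k') -> B.

(** Each turn draws a simulation. The number of turns is thus at most [size w], however large [L]
    is, and the time stays polynomial. *)
Lemma wp_block ns5 r5 r6 r7 r8 r9 r3 r4 S Q :
  ((L <= size w)%N -> forall p,
    Q (St (#|V| :: s :: tau :: L :: ns5)
       [:: c; eps; delta; p; 1; r5; r6; r7; r8; r9] S L)) ->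
  wp block_cmd (St (#|V| :: s :: tau :: 0%N :: ns5)
     [:: c; eps; delta; r3; r4; r5; r6; r7; r8; r9] S 0) Q.
Proof.
move=> hQ; apply/wp_seq/wp_setreal/wp_seq/wp_setreal => /=.
pose Inv l (st : state R V) := (l <= L)%N /\ (l <= size w)%N /\
  st = St (#|V| :: s :: tau :: l :: ns5)
     [:: c; eps; delta; decay c eps ^+ l; 1; r5; r6; r7; r8; r9] S l.
apply: (@wp_while _ _ _ _ _ _ Inv).
- by do 2 split=> //.
- by move=> l _ [_ [lw _]]; rewrite (leq_trans lw).
- move=> l _ [lL [lw ->]] /= hl.
  have lL' : (l < L)%N.
    by rewrite ltn_neqAle lL andbT; apply: contra hl => /eqP ->.
  apply/wp_seq/wp_draw => [lw'|wl].
    apply/wp_seq/wp_setnat/wp_setreal => /=; split=> //; split=> //.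
    by rewrite exprSr addn1.
  by apply: (@stuck 0) => [|k']; [rewrite mul1n (leq_ltn_trans wl)|rewrite ltn0 andbF].
- move=> l _ [lL [lw ->]] /=; rewrite negbK => hl.
  have E : l = L.
    by apply/eqP; rewrite eqn_leq lL leqNgt; apply/negP => /L_min; rewrite ltNge hl.
  by rewrite E in lw *; apply: hQ.
Qed.

Lemma wp_drawn ns rs S b j d k Q n0 n1 n2 :
  d = (k.*2.+1 * L)%N -> (d <= size w)%N ->
  (forall k', (0 < k' < k.+1)%N -> ~~ ok k') ->
  ((k.+1.*2.+1 * L <= size w)%N -> forall j',
    Q (St [:: n0, n1, n2, L, b, j' & ns] rs S (k.+1.*2.+1 * L)%N)) ->
  wp draw_cmd (St [:: n0, n1, n2, L, b, j & ns] rs S d) Q.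
Proof.
move=> dE dw rej hQ; apply/wp_seq/wp_setnat => /=.
have E : (k.+1.*2.+1 * L = d + (L + L))%N by rewrite dE addnn -(mul2n L) -mulnDl addn2.
pose Inv i (st : state R V) := (i <= L + L)%N /\ (d + i <= size w)%N /\
  st = St [:: n0, n1, n2, L, b, i & ns] rs S (d + i)%N.
apply: (@wp_while _ _ _ _ _ _ Inv).
- by split=> //; split; rewrite ?addn0.
- by move=> i _ [_ [iw _]]; rewrite (leq_trans _ wz)// (leq_trans _ iw)// leq_addl.
- move=> i _ [_ [iw ->]] /=; rewrite -ltnNge => iL.
  apply/wp_seq/wp_draw => [iw'|wi].
    by apply/wp_setnat => /=; split=> //; rewrite addnS addn1.
  by apply: (@stuck k.+1) => //; rewrite E (leq_ltn_trans wi)// ltn_add2l.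
- move=> i _ [iL [iw ->]] /=; rewrite -ltnNge -leqNgt => Li.
  have e : i = (L + L)%N by apply/eqP; rewrite eqn_leq iL.
  by rewrite e -E; apply: hQ; rewrite E -e.
Qed.

Lemma wp_search Q : (s <= z)%N ->
  (forall st' k, (0 < k)%N -> ok k ->
     (forall k', (0 < k' < k)%N -> ~~ ok k') ->
     sreg st' 0 = greedy_set H s tau (take (k * L) w) -> Q st') ->
  wp search_cmd (initial V s tau c eps delta) Q.
Proof.
move=> sz hQ.
have -> : initial V s tau c eps delta =
    St [:: #|V|; s; tau; 0; 0; 0; 0; 0; 0; 0; 0; 0; 0]%N
       [:: c; eps; delta; 0; 0; 0; 0; 0; 0; 0] [:: set0; set0; set0; set0] 0.
  rewrite /initial /St; congr State; apply/funext => i.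
  - by do 13 case: i => [//|i]; rewrite /= !nth_nil.
  - by do 10 case: i => [//|i]; rewrite /= !nth_nil.
  - by do 4 case: i => [//|i]; rewrite /= nth_nil.
apply: wp_seq; apply: wp_block => Lw p.
(* At [k = 0] no round has been played. The guard [0 < k] matters there: the average over an empty
   base is 0, so [ok 0] holds. *)
pose Inv k (st : state R V) := (k.*2.+1 * L <= size w)%N /\
  (forall k', (0 < k' < k)%N -> ~~ ok k') /\
  exists j v i t u q best r5 r6 h r8 r9 T U X Y, st = St
     [:: #|V|; s; tau; L; (k * L)%N; j; v; i; t; u; q; best;
         ((0 < k)%N && ok k : nat)]
     [:: c; eps; delta; p; delta ^+ k; r5; r6; h; r8; r9]
     [:: T; U; X; Y] (k.*2.+1 * L)%N /\
   ((0 < k)%N -> T = greedy_set H s tau (take (k * L) w)).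
apply: (@wp_while _ _ _ _ _ _ Inv).
- split; first by rewrite mul1n.
  split; first by move=> k'; rewrite ltn0 andbF.
  by do 16 eexists; split; first by rewrite mul0n mul1n.
(* As [L] is positive, there are at most as many rounds as draws. *)
- move=> k _ [kw _]; rewrite (leq_trans _ wz)// (leq_trans _ kw)//.
  by rewrite -[X in (X <= _)%N]muln1 leq_mul// -addnn -addnS leq_addr.
- move=> k _ [kw [rej [j [v [i [t [u [q [best [r5 [r6 [h [r8 [r9 [T [U [X [Y [-> TE]]]]]]]]]]]]]]]]]]] /=.
  rewrite leqn0 eqb0 => hk.
  have rej' k' : (0 < k' < k.+1)%N -> ~~ ok k'.
    rewrite ltnS => /andP[k'0]; rewrite leq_eqVlt => /orP[/eqP E|k'k].
      by move: hk; rewrite -E k'0.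
    by apply: rej; rewrite k'0.
  apply/wp_seq/wp_setnat/wp_seq/wp_setreal/wp_seq => /=.
  rewrite -mulSnr -exprSr.
  apply: (@wp_drawn _ _ _ _ _ _ k) => // kw' j2.
  have bbd : (k.+1 * L + k.+1 * L <= k.+1.*2.+1 * L)%N.
    by rewrite -mulnDl addnn leq_mul2r leqnSn orbT.
  apply: wp_seq; apply: wp_greedy => //; first exact: leq_trans (leq_addr _ _) bbd.
  move=> j3 v3 i3 t3 u3 q3 best3 r53 r63 h3 U3 X3 Y3.
  apply: wp_test => // i4 t4 u4 q4 r54 h4 r84 r94 U4 X4 Y4.
  split=> //; split=> //; do 16 eexists; split=> //.
  rewrite (negbTE hk) /=; congr (St [:: _; _; _; _; _; _; _; _; _; _; _; _; _] _ _ _).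
- move=> k _ [kw [rej [j [v [i [t [u [q [best [r5 [r6 [h [r8 [r9 [T [U [X [Y [-> TE]]]]]]]]]]]]]]]]]]] /=.
  rewrite -ltnNge lt0b => /andP[k0 okk].
  by apply: (hQ _ k) => //=; rewrite TE.
Qed.

End Search.

Lemma wp_main (R : realType) (V : finType) (H : {set V} -> R)
    (w : seq (simulation V)) (B : Prop) (z s tau : nat) (c eps delta : R)
    (L : nat) (Q : state R V -> Prop) :
  let ok k := round_ok H s tau c eps delta w L k in
  (#|V| <= z)%N -> (size w <= z)%N ->
  (0 < L)%N -> decay c eps ^+ L <= delta ->
  (forall l, (l < L)%N -> delta < decay c eps ^+ l) ->
  ((s < #|V|)%N -> 5%:R * eps < 1 -> forall k, (size w < k.*2.+1 * L)%N ->
     (forall k', (0 < k' < k)%N -> ~~ ok k') -> B) ->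
  ((#|V| <= s)%N -> forall st' : state R V, sreg st' 0 = setT -> Q st') ->
  (1 <= 5%:R * eps -> forall st' : state R V, sreg st' 0 = set0 -> Q st') ->
  ((s < #|V|)%N -> 5%:R * eps < 1 -> forall st' k, (0 < k)%N -> ok k ->
     (forall k', (0 < k' < k)%N -> ~~ ok k') ->
     sreg st' 0 = greedy_set H s tau (take (k * L) w) -> Q st') ->
  wp H w B z main_cmd (initial V s tau c eps delta) Q.
Proof.
move=> ok Vz wz L0 decayL L_min stuck h1 h2 h3; apply: wp_if => /= hs.
  pose Inv i (st : state R V) := (i <= #|V|)%N /\
    nreg st 0 = #|V| /\ nreg st 6 = i /\ sreg st 0 = [set x in take i (enum V)].
  apply: (@wp_while _ _ _ _ _ _ Inv).
  - split=> //; split=> //; split=> //=.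
    by rewrite take0; apply/setP => x; rewrite !inE.
  - by move=> i _ [iV _]; rewrite (leq_trans iV).
  - move=> i st [_ [nV [n6 E]]] /=; rewrite nV n6 -ltnNge => iV.
    have [v0 _] : exists v0 : V, v0 \in V.
      by apply/card_gt0P; exact: leq_ltn_trans iV.
    have iV' : (i < size (enum V))%N by rewrite -cardE.
    have eltE : elt V i = Some (nth v0 (enum V) i) by rewrite /elt (onth_lt v0).
    apply/wp_seq; apply: wp_step => //=; rewrite n6 eltE.
    apply: wp_step => //; split=> //; split=> //=; rewrite n6 addn1.
    split=> //; rewrite E (take_nth v0)//; apply/setP => x.
    by rewrite !inE mem_rcons inE.
  - move=> i st [iV [nV [n6 E]]] /=; rewrite nV n6 negbK => hi.
    apply: h1 => //; rewrite E take_oversize -?cardE//.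
    by apply/setP => x; rewrite !inE mem_enum.
rewrite -ltnNge in hs; apply: wp_if => /= he.
  by apply: wp_step => //; apply: h2.
rewrite -ltNge in he; apply: (wp_search Vz wz L0 decayL L_min (stuck hs he)).
  exact: leq_trans (ltnW hs) Vz.
exact: h3.
Qed.

(** * Expectations over sequences of independent simulations *)

Section Expectation.
Variables (R : realType) (I : finType) (p : I -> R).
Hypothesis p_ge0 : forall x, 0 <= p x.
Hypothesis p_sum1 : \sum_x p x = 1.
Implicit Types (f g : seq I -> R) (l : nat).

(** The expectation is defined by conditioning on the first draw, so that splitting a sequence into
    independent segments is an induction. *)
Fixpoint Ex l f : R :=
  if l is l'.+1 then \sum_x p x * Ex l' (fun w => f (x :: w)) else f [::].

Lemma Ex_tuple l f :
  \sum_(w : l.-tuple I) f w * \prod_(i < l) p (tnth w i) = Ex l f.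
Proof.
elim: l f => [|l IH] f.
  rewrite (big_pred1 [tuple]) => [|w]; first by rewrite big_ord0 mulr1.
  by apply/esym/eqP; rewrite [w]tuple0.
rewrite (reindex (fun xw : I * l.-tuple I => [tuple of xw.1 :: xw.2])) /=.
  rewrite -(pair_big predT predT (fun x (w : l.-tuple I) =>
    f (x :: w) * \prod_(i < l.+1) p (tnth [tuple of x :: w] i))) /=.
  apply: eq_bigr => x _; rewrite -IH mulr_sumr; apply: eq_bigr => w _.
  rewrite big_ord_recl tnth0 mulrCA; congr (_ * (_ * _)).
  by apply: eq_bigr => i _; rewrite tnthS.
exists (fun w => (thead w, [tuple of behead w])) => [[x w] _|w _] /=.
  by rewrite theadE; congr (_, _); apply/val_inj.
by apply/val_inj => /=; rewrite {3}(tuple_eta w).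
Qed.

(** The comparison is restricted to sequences of positive probability, since monotonicity and
    submodularity are only available there. *)
Lemma Ex_le l f g :
  (forall w, size w = l -> all (fun x => p x != 0) w -> f w <= g w) ->
  Ex l f <= Ex l g.
Proof.
elim: l f g => [|l IH] f g fg /=; first exact: fg.
apply: ler_sum => x _; have [->|px] := eqVneq (p x) 0; first by rewrite !mul0r.
by rewrite ler_wpM2l//; apply: IH => w sw wp; apply: fg; rewrite /= ?sw ?px.
Qed.

Lemma eq_Ex l f g : (forall w, size w = l -> f w = g w) -> Ex l f = Ex l g.
Proof.
elim: l f g => [|l IH] f g fg /=; first exact: fg.
by apply: eq_bigr => x _; congr (_ * _); apply: IH => w sw; rewrite fg//= sw.
Qed.

Lemma Ex_const l a : Ex l (fun=> a) = a.
Proof.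
elim: l => [//|l IH] /=; under eq_bigr do rewrite IH.
by rewrite -mulr_suml p_sum1 mul1r.
Qed.

Lemma ExZ l a f : Ex l (fun w => a * f w) = a * Ex l f.
Proof.
elim: l f => [//|l IH] f /=; rewrite mulr_sumr.
by apply: eq_bigr => x _; rewrite IH mulrCA.
Qed.

Lemma ExD l f g : Ex l (fun w => f w + g w) = Ex l f + Ex l g.
Proof.
elim: l f g => [//|l IH] f g /=; rewrite -big_split.
by apply: eq_bigr => x _; rewrite IH mulrDr.
Qed.

Lemma Ex_sum l (J : Type) (r : seq J) (f : J -> seq I -> R) :
  Ex l (fun w => \sum_(j <- r) f j w) = \sum_(j <- r) Ex l (f j).
Proof.
elim: r => [|j r IH].
  by under eq_Ex do rewrite big_nil; rewrite big_nil Ex_const.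
by under eq_Ex do rewrite big_cons; rewrite big_cons ExD IH.
Qed.

Lemma Ex_cat a b f : Ex (a + b) f = Ex a (fun u => Ex b (fun v => f (u ++ v))).
Proof.
elim: a f => [//|a IH] f /=.
by apply: eq_bigr => x _; rewrite IH.
Qed.

Lemma Ex_take a l f : (a <= l)%N -> Ex l (fun w => f (take a w)) = Ex a f.
Proof.
move=> al; rewrite -{1}(subnKC al) Ex_cat; apply: eq_Ex => u su.
by under eq_Ex do rewrite take_size_cat//; rewrite Ex_const.
Qed.

(** Independence of base and pool: the base can be fixed while averaging over the pool. *)
Lemma Ex_take2 a b l (f : seq I -> seq I -> R) : (a + b <= l)%N ->
  Ex l (fun w => f (take a w) (take b (drop a w))) =
  Ex a (fun u => Ex b (f u)).
Proof.
move=> abl; have al := leq_trans (leq_addr b a) abl.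
rewrite -(subnKC al) Ex_cat; apply: eq_Ex => u su.
under eq_Ex do rewrite take_size_cat// drop_size_cat//.
by apply: Ex_take; rewrite leq_subRL.
Qed.

Lemma Ex_prod l (g : I -> R) :
  Ex l (fun w => \prod_(x <- w) g x) = (\sum_x p x * g x) ^+ l.
Proof.
elim: l => [|l IH] /=; first by rewrite big_nil.
under eq_bigr => x _ do under eq_Ex do rewrite big_cons.
by under eq_bigr do rewrite ExZ IH mulrA; rewrite -mulr_suml exprS.
Qed.

Lemma Ex_union l (As : seq (seq I -> bool)) :
  Ex l (fun w => (has (fun A => A w) As)%:R) <=
  \sum_(A <- As) Ex l (fun w => (A w)%:R).
Proof.
rewrite -Ex_sum; apply: Ex_le => // w _ _.
elim: As => [|A As IH] /=; first by rewrite big_nil.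
rewrite big_cons; case: (A w) => /=; last by rewrite add0r.
by rewrite lerDl sumr_ge0.
Qed.

Lemma Ex_compl l (A : seq I -> bool) :
  Ex l (fun w => (~~ A w)%:R) = 1 - Ex l (fun w => (A w)%:R).
Proof.
rewrite -[X in X - _](Ex_const l) -[X in _ - X]mul1r -mulN1r mul1r -ExZ -ExD.
by apply: eq_Ex => w _; case: (A w); rewrite mulN1r ?subrr ?subr0.
Qed.

(** Markov's inequality for a product of independent factors. It is applied with [a] equal to [D]
    for unsound acceptance, 1 for the lower tail, and the inverse of [delta ^+ k] for rejection. *)
Lemma markov_prod l (E : seq I -> bool) (a : R) (g : I -> R) :
  0 <= a -> (forall x, 0 <= g x) ->
  (forall w, size w = l -> E w -> 1 <= a * \prod_(x <- w) g x) ->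
  Ex l (fun w => (E w)%:R) <= a * (\sum_x p x * g x) ^+ l.
Proof.
move=> a0 g0 h; rewrite -Ex_prod -ExZ; apply: Ex_le => w sw _.
case: (boolP (E w)) => [/(h _ sw)//|_]; apply: mulr_ge0 => //.
exact: prodr_ge0.
Qed.

(* The reciprocal of a product of the factors [(1 + lam X) / (1 + lam a)] has a
   small mean when [a] is below the mean of [X]; this replaces the exponential
   moment in a bound on the lower tail. *)
Lemma mean_inv_factor (X : I -> R) (lam a mu m : R) :
  (forall x, 0 <= X x) -> 0 <= lam -> 0 <= a -> lam * m <= mu ->
  mu <= \sum_x p x * X x -> \sum_x p x * X x ^+ 2 <= m ->
  \sum_x p x * ((1 + lam * X x) / (1 + lam * a))^-1 <=
    1 - lam * (mu - a) + lam ^+ 2 * m.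
Proof.
move=> X0 lam0 a0 lm hmu hm.
have la0 : 0 <= lam * a by apply: mulr_ge0.
have inv x : (1 + lam * X x)^-1 <= 1 - lam * X x + lam ^+ 2 * X x ^+ 2.
  have y0 : 0 <= lam * X x by apply: mulr_ge0.
  rewrite -exprMn; set y := lam * X x in y0 *.
  rewrite -[X in X <= _]mul1r ler_pdivrMr; last lra.
  have -> : (1 - y + y ^+ 2) * (1 + y) = 1 + y ^+ 3 by ring.
  by rewrite lerDl exprn_ge0.
have -> : \sum_x p x * ((1 + lam * X x) / (1 + lam * a))^-1 =
    (1 + lam * a) * \sum_x p x * (1 + lam * X x)^-1.
  by rewrite mulr_sumr; apply: eq_bigr => x _; rewrite invf_div mulrCA.
have le1 : \sum_x p x * (1 + lam * X x)^-1 <= 1 - lam * mu + lam ^+ 2 * m.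
  apply: (@le_trans _ _
    (\sum_x (p x - lam * (p x * X x) + lam ^+ 2 * (p x * X x ^+ 2)))).
    apply: ler_sum => x _; apply: le_trans (ler_wpM2l (p_ge0 x) (inv x)) _.
    by rewrite le_eqVlt; apply/orP; left; apply/eqP; ring.
  rewrite big_split sumrB -!mulr_sumr p_sum1 /= lerD//; last first.
    by rewrite ler_wpM2l// exprn_ge0.
  by rewrite lerB// ler_wpM2l.
apply: le_trans (ler_wpM2l _ le1) _; first lra.
(* Expanding the product gives the claimed bound minus this term; here [lam * m <= mu] enters. *)
have : 0 <= lam * a * (lam * (mu - lam * m)).
  by rewrite mulr_ge0// mulr_ge0// subr_ge0.
by lra.
Qed.

Lemma prod1D_le_expR (y : seq I) (g : I -> R) : (forall x, 0 <= 1 + g x) ->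
  \prod_(x <- y) (1 + g x) <= expR (\sum_(x <- y) g x).
Proof.
move=> g0; elim: y => [|x y IH]; first by rewrite !big_nil expR0.
rewrite !big_cons expRD ler_pM//; first exact: prodr_ge0.
exact: expR_ge1Dx.
Qed.

End Expectation.

Lemma prob_Ex (R : realType) (V : finType) (G : sdm R V) l
    (E : seq (simulation V) -> Prop) :
  prob G (fun w : l.-tuple (simulation V) => E w) =
  Ex (pmf G) l (fun w => (`[< E w >])%:R).
Proof.
rewrite -Ex_tuple /prob big_mkcond; apply: eq_bigr => w _.
by case: asboolP => _; rewrite ?mul1r ?mul0r.
Qed.

(** * The greedy algorithm and the influence function *)

Section Greedy.
Variables (R : realType) (V : finType) (F : {set V} -> R).
Implicit Types (S T : {set V}).
Hypothesis F_ge0 : forall S, 0 <= F S.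
Hypothesis F_mono : forall S T, S \subset T -> F S <= F T.

Lemma sub_add_elt u T : T \subset add_elt u T.
Proof. by rewrite /add_elt; case: elt => [v|]; rewrite ?subsetU1. Qed.

Lemma best_index_max T v : F (v |: T) <= F (add_elt (best_index F T) T).
Proof.
pose p m := foldl (better F T) (0%N, 0) (iota 0 m).
have [inv1 inv2] : (forall u, (u < #|V|)%N -> F (add_elt u T) <= (p #|V|).2) /\
    ((0 < #|V|)%N -> (p #|V|).2 = F (add_elt (p #|V|).1 T)).
  suff [_ [h1 h2]] : 0 <= (p #|V|).2 /\
    (forall u, (u < #|V|)%N -> F (add_elt u T) <= (p #|V|).2) /\
    ((0 < #|V|)%N -> (p #|V|).2 = F (add_elt (p #|V|).1 T)) by [].
  elim: #|V| => [//|m [p0 [h1 h2]]].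
  have -> : p m.+1 = better F T (p m) m by rewrite /p -addn1 iotaD foldl_cat.
  rewrite /better; case: (leP (p m).2 (F (add_elt m T))) => /= h.
    split=> //; split=> // u; rewrite ltnS leq_eqVlt => /orP[/eqP->//|um].
    exact: le_trans (h1 _ um) h.
  split=> //; split=> [u|_].
    by rewrite ltnS leq_eqVlt => /orP[/eqP->|/h1//]; exact: ltW.
  (* The first candidate cannot lose to the initial value 0, because [F] is nonnegative. *)
  case: m h1 h2 h {p0} => [_ _ /=|m _ h2 _]; last exact: h2.
  by rewrite ltNge F_ge0.
have V0 : (0 < #|V|)%N by apply/card_gt0P; exists v.
rewrite -[best_index F T]/(p #|V|).1 -inv2//.
have := inv1 _ (ltn_ord (enum_rank v)); rewrite /add_elt /elt.
by rewrite (onth_lt v) -?cardE// nth_enum_rank.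
Qed.

Lemma card_greedy j : (#|greedy F j| <= j)%N.
Proof.
elim: j => [|j IH]; first by rewrite cards0.
rewrite /= /add_elt; case: elt => [v|]; last exact: leq_trans (leqnSn _).
by rewrite cardsU1 (leq_add (leq_b1 _) IH).
Qed.

Lemma greedy_sub j i : (j <= i)%N -> greedy F j \subset greedy F i.
Proof.
move=> /subnKC <-; elim: (i - j)%N => [|d IH]; first by rewrite addn0.
by rewrite addnS (subset_trans IH)//= sub_add_elt.
Qed.

Lemma greedy_ge_card1 T s : (#|T| <= 1)%N -> (0 < s)%N -> F T <= F (greedy F s).
Proof.
move=> T1 s0; have [->|[v vT]] := set_0Vmem T; first by apply: F_mono; rewrite sub0set.
have -> : T = [set v].
  by apply/eqP; rewrite eq_sym eqEcard sub1set vT cards1.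
apply: le_trans (F_mono (greedy_sub s0)).
by rewrite /= -[[set v]]setU0; apply: best_index_max.
Qed.

Hypothesis F_submod : submodular F.

(** Elements are added one at a time. Submodularity is applied to [T] with [r] and [T] with [v],
    whose intersection contains [T]. *)
Lemma submodular_marginals T (r : seq V) :
  F (T :|: [set x in r]) <= F T + \sum_(v <- r) (F (v |: T) - F T).
Proof.
elim: r => [|v r IH].
  rewrite big_nil addr0; apply: F_mono.
  by apply/subsetP => x; rewrite !inE orbF.
rewrite big_cons.
have := F_submod (T :|: [set x in r]) (v |: T).
have -> : T :|: [set x in r] :|: (v |: T) = T :|: [set x in v :: r].
  by apply/setP => x; rewrite !inE; case: (x \in T); rewrite ?orbT ?orbF//= orbC.
have : F T <= F ((T :|: [set x in r]) :&: (v |: T)).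
  by apply: F_mono; rewrite subsetI subsetUl subsetUr.
by move: IH; lra.
Qed.

(** The gap to [F S] is at most a sum of [#|S|] marginal gains at the current set, none larger than
    the greedy gain. *)
Lemma greedy_step S s j : (#|S| <= s)%N ->
  F S - F (greedy F j) <= s%:R * (F (greedy F j.+1) - F (greedy F j)).
Proof.
move=> Ss; set T := greedy F j.
have inc : 0 <= F (greedy F j.+1) - F T.
  by rewrite subr_ge0; apply: F_mono; apply: greedy_sub.
apply: (@le_trans _ _ (#|S|%:R * (F (greedy F j.+1) - F T))); last first.
  by rewrite ler_wpM2r// ler_nat.
have := submodular_marginals T (enum S).
have : F S <= F (T :|: [set x in enum S]).
  by apply: F_mono; apply/subsetP => x xS; rewrite !inE mem_enum xS orbT.
have : \sum_(v <- enum S) (F (v |: T) - F T) <= #|S|%:R * (F (greedy F j.+1) - F T).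
  rewrite mulr_natl -sumr_const big_enum /=; apply: ler_sum => v _.
  by rewrite lerB//; apply: best_index_max.
rewrite -/T; lra.
Qed.

(** By [greedy_step], each step shrinks the gap to [F S] by the factor [1 - 1 / s]. *)
Lemma greedy_approx S s : (0 < s)%N -> (#|S| <= s)%N ->
  (1 - (1 - s%:R^-1) ^+ s) * F S <= F (greedy F s).
Proof.
move=> s0 Ss; have sR : 0 < s%:R :> R by rewrite ltr0n.
have sV1 : s%:R^-1 <= 1 :> R by rewrite invf_le1// ler1n.
suff /(_ s) : forall j, F S - F (greedy F j) <= (1 - s%:R^-1) ^+ j * F S.
  by rewrite mulrBl mul1r; lra.
elim=> [|j IH]; first by rewrite expr0 mul1r lerBlDr lerDl.
have := greedy_step j Ss; rewrite -ler_pdivrMl// => h.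
rewrite exprS -mulrA.
apply: (@le_trans _ _ ((1 - s%:R^-1) * (F S - F (greedy F j)))).
  by rewrite mulrBl mul1r; lra.
by rewrite ler_wpM2l// subr_ge0.
Qed.

End Greedy.

(** * Moments of rewards and the optimal values *)

Section Influence.
Variables (R : realType) (V : finType) (G : sdm R V) (tau : nat).
Implicit Types (S T : {set V}).
Local Notation rew := (reward G tau).
Local Notation inf := (influence G tau).

Lemma reward_ge0 phi T : 0 <= rew phi T.
Proof. exact: util_ge0. Qed.

Lemma reward_mono phi S T : monotone_family phi -> S \subset T -> rew phi S <= rew phi T.
Proof. by move=> mono ST; apply/util_mono/reach_mono. Qed.

Lemma influence_ge0 T : 0 <= inf T.
Proof. by apply: sumr_ge0 => phi _; rewrite mulr_ge0 ?pmf_ge0 ?reward_ge0. Qed.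

Lemma opt_ge0 s : 0 <= opt G tau s.
Proof. exact: bigmax_ge_id. Qed.

Lemma influence_le_opt s T : (#|T| <= s)%N -> inf T <= opt G tau s.
Proof. by move=> Ts; apply: le_bigmax_cond. Qed.

Lemma opt_mono s s' : (s <= s')%N -> opt G tau s <= opt G tau s'.
Proof.
move=> ss'; apply: bigmax_le; first exact: opt_ge0.
by move=> T Ts; apply: influence_le_opt; apply: leq_trans ss'.
Qed.

Lemma opt_attained s : exists2 T : {set V}, (#|T| <= s)%N & inf T = opt G tau s.
Proof.
have s0 : (#|set0 : {set V}| <= s)%N by rewrite cards0.
have [T Ts E] := eq_bigmax (x := 0) set0 (fun T : {set V} => (#|T| <= s)%N) inf s0
  (fun T _ => influence_ge0 T).
by exists T; rewrite // /opt E.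
Qed.

(** The second moment is the variance plus the squared mean, and each is at most [c] times the
    squared maximum; singletons are bounded by [opt 1]. *)
Lemma second_moment c T : 1 <= c -> variance_bounded G tau c ->
  \sum_phi pmf G phi * rew phi T ^+ 2 <=
    2%:R * c * Num.max (inf T) (opt G tau 1) ^+ 2.
Proof.
move=> c1 /(_ T); set M := Num.max _ (opt G tau 1); set M' := Num.max _ _ => hv.
have I0 := influence_ge0 T.
have M'M : M' <= M.
  rewrite ge_max le_max lexx /= le_max; apply/orP; right.
  apply: bigmax_le => [|v _]; first exact: opt_ge0.
  by apply: influence_le_opt; rewrite cards1.
have IM : inf T <= M by rewrite le_max lexx.
have varE : reward_variance G tau T =
    \sum_phi pmf G phi * rew phi T ^+ 2 - inf T ^+ 2.
  rewrite /reward_variance; under eq_bigr => phi _.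
    rewrite (_ : _ * _ = pmf G phi * rew phi T ^+ 2 -
      (2%:R * inf T) * (pmf G phi * rew phi T) + pmf G phi * inf T ^+ 2); last ring.
    over.
  rewrite big_split sumrB -mulr_sumr -mulr_suml pmf_sum1 -/(influence G tau T) /=.
  ring.
have : c * inf T * M' <= c * M ^+ 2.
  by rewrite -mulrA ler_wpM2l ?(le_trans ler01)// expr2 ler_pM// (le_trans I0)// le_max lexx.
have : inf T ^+ 2 <= c * M ^+ 2.
  have : inf T ^+ 2 <= M ^+ 2 by rewrite lerXn2r// nnegrE ?(le_trans I0).
  have : M ^+ 2 <= c * M ^+ 2 by rewrite ler_peMl// sqr_ge0.
  lra.
move: hv; rewrite varE; lra.
Qed.

Lemma pmf_mean_ge0 (f : simulation V -> R) :
  (forall phi, 0 <= f phi) -> 0 <= \sum_phi pmf G phi * f phi.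
Proof. by move=> f0; apply: sumr_ge0 => phi _; rewrite mulr_ge0 ?pmf_ge0. Qed.

End Influence.

(** * One round *)

Section Round.
Variables (R : realType) (V : finType) (G : sdm R V) (tau s : nat).
Variables (c eps delta : R).
Hypothesis s_gt0 : (0 < s)%N.
Hypothesis c_ge1 : 1 <= c.
Hypothesis eps_gt0 : 0 < eps.
Hypothesis eps_lt : 5%:R * eps < 1.
Hypothesis variance_le : variance_bounded G tau c.

Local Notation H := (util G).
Local Notation rew := (reward G tau).
Local Notation inf := (influence G tau).
Local Notation OPT := (opt G tau).
Local Notation est := (estimate H tau).
Local Notation lam := (rate c eps).
Local Notation rho := (decay c eps).
Local Notation E := (Ex (pmf G)).
Local Notation possible := (all (fun phi => pmf G phi != 0)).
Implicit Types (x y : seq (simulation V)) (S T : {set V}).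

Let p0 := pmf_ge0 G.
Let p1 := pmf_sum1 G.

Lemma c_gt0 : 0 < c. Proof. exact: lt_le_trans c_ge1. Qed.

Lemma rate_gt0 : 0 < lam.
Proof. by rewrite divr_gt0// mulr_gt0// c_gt0. Qed.

Lemma rate_c : lam * c = eps / 5%:R.
Proof. by rewrite /rate; field; rewrite gt_eqF ?c_gt0. Qed.

Lemma decayE : rho = 1 - lam * eps / 2%:R.
Proof. by rewrite /decay /rate; field; rewrite gt_eqF ?c_gt0. Qed.

Lemma rate_le : lam <= 1 / 25%:R.
Proof.
have := rate_gt0; have : lam <= lam * c by rewrite ler_peMr// ltW// rate_gt0.
by rewrite rate_c; move: eps_lt; lra.
Qed.

Lemma decay_gt0 : 0 < rho.
Proof.
rewrite decayE; have : lam * eps <= 1 / 25%:R * 1.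
  by rewrite ler_pM ?rate_le// ?ltW// ?rate_gt0//; move: eps_lt eps_gt0; lra.
lra.
Qed.

Lemma estimate_ge0 x T : 0 <= est x T.
Proof. by rewrite divr_ge0// sumr_ge0// => phi _; rewrite util_ge0. Qed.

Lemma mean_scaled T a : \sum_phi pmf G phi * (rew phi T / a) = inf T / a.
Proof. by rewrite mulr_suml; apply: eq_bigr => phi _; rewrite mulrA. Qed.

Lemma sq_mean_scaled T a : \sum_phi pmf G phi * (rew phi T / a) ^+ 2 =
  (\sum_phi pmf G phi * rew phi T ^+ 2) / a ^+ 2.
Proof.
by rewrite mulr_suml; apply: eq_bigr => phi _; rewrite expr_div_n mulrA.
Qed.

Definition unsound (D : R) x y : bool :=
  [&& accept_block H s tau c eps D x y, 0 < est x (greedy_set H s tau x) &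
   inf (greedy_set H s tau x) <
     (1 - 4%:R * eps) * est x (greedy_set H s tau x)].

(** With [x] fixed, [T] and [A] are constants, so the bets on the pool are independent, with mean at
    most 1 when the influence is below the target. *)
Lemma unsound_prob D x l : 0 <= D -> E l (fun y => (unsound D x y)%:R) <= D.
Proof.
move=> D0; rewrite /unsound /accept_block; set T := greedy_set _ _ _ _.
set A := est x T; case: (ltP 0 A) => [A0|_]; last first.
  by under eq_Ex do rewrite andbF; rewrite (Ex_const p1).
case: (ltP (inf T)) => [small|_]; last first.
  by under eq_Ex do rewrite !andbF; rewrite (Ex_const p1).
under eq_Ex do rewrite !andbT /accept leNgt A0 /=.
have a0 : 0 <= 1 - 4%:R * eps by move: eps_lt eps_gt0; lra.
have den : 0 < 1 + lam * (1 - 4%:R * eps).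
  by rewrite ltr_pwDl// mulr_ge0// ltW// rate_gt0.
have g0 phi : 0 <= wager c eps A (rew phi T).
  apply: divr_ge0; last exact: ltW.
  by rewrite addr_ge0// mulr_ge0 ?(ltW rate_gt0)// divr_ge0 ?reward_ge0// ltW.
apply: le_trans (markov_prod p0 D0 g0 _) _ => //.
rewrite -[leRHS]mulr1 ler_wpM2l// exprn_ile1 ?pmf_mean_ge0//.
have -> : \sum_phi pmf G phi * wager c eps A (rew phi T) =
    (1 + lam * (inf T / A)) / (1 + lam * (1 - 4%:R * eps)).
  rewrite -mean_scaled mulr_sumr -{1}p1 -big_split mulr_suml /=.
  by apply: eq_bigr => phi _; rewrite /wager; ring.
rewrite ler_pdivrMr// mul1r lerD2l ler_pM2l ?rate_gt0//.
by rewrite ler_pdivrMr// ltW.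
Qed.

(** The set [S] does not depend on the sample, so Markov's inequality applies directly to the
    inverse factors, with rewards scaled by [OPT s]. *)
Lemma lower_tail_prob S l :
  inf S = OPT s -> (0 < l)%N ->
  E l (fun x => (est x S < (1 - eps) * OPT s)%R%:R) <= rho ^+ l.
Proof.
move=> IS l0; have := opt_ge0 G tau s; rewrite le_eqVlt => /orP[/eqP O0|O0].
  (* When the optimum is 0, scaling is impossible, but so is the event. *)
  under eq_Ex do rewrite -O0 mulr0 ltNge estimate_ge0.
  by rewrite (Ex_const p1) exprn_ge0// ltW ?decay_gt0.
set O := OPT s in IS O0 *.
have eps1 : eps < 1 by move: eps_lt eps_gt0; lra.
have lam0 := ltW rate_gt0.
have a0 : 0 <= 1 - eps by lra.
have den : 0 < 1 + lam * (1 - eps) by rewrite ltr_pwDl// mulr_ge0.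
have X0 phi : 0 <= rew phi S / O by rewrite divr_ge0 ?reward_ge0// ltW.
pose f phi := (1 + lam * (rew phi S / O)) / (1 + lam * (1 - eps)).
have f0 phi : 0 < f phi by rewrite divr_gt0// ltr_pwDl// mulr_ge0.
have g0 phi : 0 <= (f phi)^-1 by rewrite invr_ge0 ltW.
have := markov_prod (l := l) p0
  (E := fun x => est x S < (1 - eps) * OPT s) ler01 g0.
rewrite mul1r => markov; apply: le_trans (markov _) _ => {markov}.
  move=> x sx small; rewrite mul1r prodfV; rewrite invf_ge1; last first.
    by rewrite prodr_gt0.
  (* A low average makes these increments sum to at most 0, and then the product of the factors is
     at most 1. *)
  have fE phi : f phi = 1 + lam * (rew phi S / O - (1 - eps)) / (1 + lam * (1 - eps)).
    by rewrite /f; field; rewrite !gt_eqF.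
  under eq_bigr do rewrite fE.
  apply: le_trans (prod1D_le_expR _ _) _; first by move=> phi; rewrite -fE ltW.
  rewrite expR_le1 -mulr_suml -mulr_sumr pmulr_lle0 ?invr_gt0//.
  rewrite pmulr_rle0 ?rate_gt0// sumrB -mulr_suml big_const_seq count_predT sx.
  rewrite iter_addr_0 -mulr_natl subr_le0 ler_pdivrMr//.
  move: small; rewrite /estimate sx ltr_pdivrMr ?ltr0n// => /ltW.
  by move=> /le_trans; apply; rewrite [leRHS](_ : _ = (1 - eps) * O * l%:R)//; ring.
have sm : \sum_phi pmf G phi * (rew phi S / O) ^+ 2 <= 2%:R * c.
  rewrite sq_mean_scaled ler_pdivrMr ?exprn_gt0//.
  apply: le_trans (second_moment S c_ge1 variance_le) _.
  rewrite ler_wpM2l ?mulr_ge0 ?(ltW c_gt0)// lerXn2r ?nnegrE//.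
  - by rewrite le_max influence_ge0.
  - exact: ltW.
  - by rewrite ge_max IS lexx opt_mono.
apply: lerXn2r; rewrite ?nnegrE ?(ltW decay_gt0) ?pmf_mean_ge0//.
apply: le_trans (mean_inv_factor (mu := 1) p0 p1 X0 lam0 a0 _ _ sm) _.
- by rewrite mulrCA rate_c; lra.
- by rewrite mean_scaled IS divff// gt_eqF.
(* The mean is at most [1 - lam eps + (2/5) lam eps], which is below [rho = 1 - lam eps / 2]. *)
- have -> : lam ^+ 2 * (2%:R * c) = 2%:R / 5%:R * (lam * eps).
    have -> : lam ^+ 2 * (2%:R * c) = 2%:R * lam * (lam * c) by ring.
    by rewrite rate_c; field.
  have : 0 < lam * eps by rewrite mulr_gt0 ?rate_gt0.
  by rewrite decayE; lra.
Qed.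

(** * Estimates and the test for a fixed base *)

Section Base.
Variable x : seq (simulation V).
Hypothesis x_possible : possible x.
Hypothesis x_nonempty : (0 < size x)%N.
Local Notation T := (greedy_set H s tau x).
Local Notation F := (total_util H tau x).

Lemma total_estimate S : F S = (size x)%:R * est x S.
Proof. by rewrite mulrCA divff ?mulr1// pnatr_eq0 -lt0n. Qed.

Lemma estimate_le S S' : (est x S <= est x S') = (F S <= F S').
Proof. by rewrite !total_estimate ler_pM2l// ltr0n. Qed.

Lemma total_ge0 S : 0 <= F S.
Proof. by rewrite sumr_ge0// => phi _; rewrite util_ge0. Qed.

Lemma total_mono S S' : S \subset S' -> F S <= F S'.
Proof.
move=> SS'; rewrite /total_util big_seq [leRHS]big_seq; apply: ler_sum => phi phix.
by apply: reward_mono => //; apply/pmf_monotone/(allP x_possible).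
Qed.

Lemma greedy_estimate S :
  submodular (avg_oracle G tau x) -> (#|S| <= s)%N ->
  (1 - (1 - s%:R^-1) ^+ s) * est x S <= est x T.
Proof.
move=> sub Ss; have xR : 0 < (size x)%:R :> R by rewrite ltr0n.
rewrite -(ler_pM2l xR) mulrCA -!total_estimate.
apply: greedy_approx => //; [exact: total_ge0|exact: total_mono|].
move=> A B; rewrite !total_estimate -!mulrDr ler_pM2l//.
by rewrite /estimate ![_ / (size x)%:R]mulrC; apply: sub.
Qed.

(* Already the first greedy step makes the estimate comparable to OPT_1. *)
Lemma uniform_estimate :
  uniform_approx G tau eps s (avg_oracle G tau x) ->
  let M := Num.max (inf T) (OPT 1) in
  (1 - eps) * M <= est x T /\ est x T - eps * M <= inf T.
Proof.
move=> unif; have approx S : (#|S| <= s)%N ->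
    `|est x S - inf S| <= eps * Num.max (inf S) (OPT 1).
  by move=> /unif; rewrite /approx_at /avg_oracle /estimate mulrC.
have := approx T (card_greedy _ _); set M := Num.max _ _.
rewrite ler_distl => /andP[h1 h2] /=; split; last by move: h2; lra.
rewrite /M; case: (leP (OPT 1) (inf T)) => h.
  by move: h1; rewrite /M; case: leP h => //; lra.
have [S S1 IS] := opt_attained G tau 1.
have := approx S (leq_trans S1 s_gt0); rewrite IS maxxx ler_distl => /andP[h3 _].
apply: (@le_trans _ _ (est x S)); first lra.
rewrite estimate_le; apply: greedy_ge_card1 => //.
  exact: total_ge0.
exact: total_mono.
Qed.

(** Rejection means that the product of the inverse factors exceeds [delta ^+ k]. Markov's
    inequality then costs [delta ^- k], so the mean of an inverse factor has to be at most
    [rho ^+ 2] rather than [rho]. *)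
Lemma reject_prob k l :
  uniform_approx G tau eps s (avg_oracle G tau x) ->
  0 < delta -> rho ^+ l <= delta ^+ k ->
  E l (fun y => (~~ accept_block H s tau c eps (delta ^+ k) x y)%:R) <= delta ^+ k.
Proof.
move=> unif d0 rhol; have [lbM lbI] := uniform_estimate unif.
rewrite /accept_block; set A := est x T in lbM lbI *.
set M := Num.max _ _ in lbM lbI.
case: (leP A 0) => [A0|A0].
  under eq_Ex do rewrite /accept A0.
  by rewrite (Ex_const p1) exprn_ge0// ltW.
under eq_Ex do rewrite /accept leNgt A0 /= -ltNge.
have D0 : 0 < delta ^+ k by rewrite exprn_gt0.
have lam0 := ltW rate_gt0.
have a0 : 0 <= 1 - 4%:R * eps by move: eps_lt eps_gt0; lra.
have den : 0 < 1 + lam * (1 - 4%:R * eps) by rewrite ltr_pwDl// mulr_ge0.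
have X0 phi : 0 <= rew phi T / A by rewrite divr_ge0 ?reward_ge0// ltW.
have f0 phi : 0 < wager c eps A (rew phi T) by rewrite divr_gt0// ltr_pwDl// mulr_ge0.
have g0 phi : 0 <= (wager c eps A (rew phi T))^-1 by rewrite invr_ge0 ltW.
have Dinv : 0 <= (delta ^+ k)^-1 by rewrite invr_ge0 ltW.
apply: le_trans (markov_prod p0 Dinv g0 _) _.
  move=> y _ small; rewrite prodfV -invfM invf_ge1 ?mulr_gt0 ?prodr_gt0//.
  exact: ltW.
have M0 : 0 <= M by rewrite le_max influence_ge0.
have MA : M <= 5%:R / 4%:R * A.
  have : 4%:R / 5%:R * M <= (1 - eps) * M.
    by rewrite ler_wpM2r//; move: eps_lt; lra.
  lra.
(* The constant is [2 (5/4)^2], from [second_moment] and [M <= (5/4) A]. *)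
have sm : \sum_phi pmf G phi * (rew phi T / A) ^+ 2 <= 25%:R / 8%:R * c.
  rewrite sq_mean_scaled ler_pdivrMr ?exprn_gt0//.
  apply: le_trans (second_moment T c_ge1 variance_le) _; rewrite -/M.
  have : M ^+ 2 <= (5%:R / 4%:R * A) ^+ 2.
    by rewrite lerXn2r// nnegrE// (le_trans M0).
  have cc := c_gt0; move=> /(ler_wpM2l (ltW cc)); lra.
have mu : 1 - 5%:R / 4%:R * eps <= inf T / A.
  by rewrite ler_pdivlMr//; have := ler_wpM2l (ltW eps_gt0) MA; lra.
have le_rho2 : \sum_phi pmf G phi * (wager c eps A (rew phi T))^-1 <= rho ^+ 2.
  apply: le_trans (mean_inv_factor (mu := 1 - 5%:R / 4%:R * eps) p0 p1 X0 lam0 a0 _ _ sm) _.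
  - by rewrite mulrCA rate_c; move: eps_lt; lra.
  - by rewrite mean_scaled.
  (* The gap between the mean and the target is [(4 - 5/4) eps], so the bound is
     [1 - (17/8) lam eps], while [rho ^+ 2 >= 1 - lam eps]. *)
  - have -> : lam ^+ 2 * (25%:R / 8%:R * c) = 5%:R / 8%:R * (lam * eps).
      have -> : lam ^+ 2 * (25%:R / 8%:R * c) = 25%:R / 8%:R * lam * (lam * c) by ring.
      by rewrite rate_c; field.
    have : 0 < lam * eps by rewrite mulr_gt0 ?rate_gt0.
    rewrite decayE; have : 0 <= (lam * eps / 2%:R) ^+ 2 by rewrite sqr_ge0.
    by lra.
have : (\sum_phi pmf G phi * (wager c eps A (rew phi T))^-1) ^+ l <= (delta ^+ k) ^+ 2.
  apply: (@le_trans _ _ ((rho ^+ 2) ^+ l)).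
    by apply: lerXn2r; rewrite ?nnegrE ?pmf_mean_ge0// exprn_ge0// ltW// decay_gt0.
  rewrite exprAC lerXn2r// nnegrE ?(ltW D0)// exprn_ge0// ltW// decay_gt0//.
by move=> /(ler_wpM2l Dinv) /le_trans; apply; rewrite expr2 mulKf// gt_eqF.
Qed.

(** The greedy guarantee, applied to the estimates, compares [T] with [S]. If the estimate at [T] is
    not positive, the target is at most 0. *)
Lemma sound_greedy_set S :
  submodular (avg_oracle G tau x) -> (#|S| <= s)%N ->
  (1 - eps) * OPT s <= est x S ->
  (est x T <= 0) || ((1 - 4%:R * eps) * est x T <= inf T) ->
  (1 - (1 - s%:R^-1) ^+ s) * (1 - 5%:R * eps) * OPT s <= inf T.
Proof.
move=> sub Ss lowS; set K := 1 - _ ^+ s.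
have K0 : 0 <= K.
  have s1 : s%:R^-1 <= 1 :> R by rewrite invf_le1 ?ler1n// ltr0n.
  by rewrite subr_ge0 exprn_ile1// ?subr_ge0// gerBl invr_ge0.
have := greedy_estimate sub Ss; rewrite -/K => gr.
have O0 := opt_ge0 G tau s.
have KO : K * ((1 - eps) * OPT s) <= est x T.
  exact: le_trans (ler_wpM2l K0 lowS) gr.
have KO0 : 0 <= K * OPT s by rewrite mulr_ge0.
move=> /orP[A0|snd].
  apply: le_trans (influence_ge0 _ _ T).
  have := le_trans KO A0; rewrite mulrCA => KO1.
  have : K * OPT s <= 0.
    by rewrite -(pmulr_rle0 _ (_ : 0 < 1 - eps))//; move: eps_lt eps_gt0; lra.
  by rewrite mulrAC => h; rewrite mulr_le0_ge0//; move: eps_lt; lra.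
apply: le_trans snd.
have a0 : 0 <= 1 - 4%:R * eps by move: eps_lt eps_gt0; lra.
apply: le_trans (ler_wpM2l a0 KO).
(* The product [(1 - 4 eps) (1 - eps)] exceeds [1 - 5 eps] by [4 eps^2]. *)
have : 0 <= eps ^+ 2 * (K * OPT s) by rewrite mulr_ge0// sqr_ge0.
lra.
Qed.

End Base.

End Round.

(** * All rounds *)

(** Halted and starved configurations are fixed points of [step], so running beyond the needed time
    changes nothing. *)
Lemma wp_run (R : realType) (V : finType) (H : {set V} -> R)
    (w : seq (simulation V)) (B : Prop) z time c st (Q : state R V -> Prop) :
  (cost z c <= time)%N -> wp H w B z c st Q ->
  (B /\ starved w (run H w c st time)) \/
  (halted (run H w c st time) /\ Q (run H w c st time).2).
Proof.
move=> cz [t tc E]; rewrite /run -(subnK (leq_trans tc cz)) iterD.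
case: E => [[st' Qst' ->]|[b /(_ [::])]].
  suff -> : iter (time - t) (step H w) ([::], st') = ([::], st') by right.
  by elim: (time - t)%N => [//|d /= ->].
set cf := iter t _ _ => stv; left; split=> //.
suff -> : iter (time - t) (step H w) cf = cf by [].
elim: (time - t)%N => [//|d /= ->]; move: stv; rewrite /starved.
by case: cf => -[//|[]//= k st'']; rewrite ltnNge => ->.
Qed.

(** * Existence and size of the block length *)

Section BlockLength.
Variables (R : realType) (c eps delta : R).
Hypothesis c_ge1 : 1 <= c.
Hypothesis eps01 : 0 < eps < 1.
Hypothesis delta01 : 0 < delta < 1.

Let x : R := eps * eps / (10%:R * c).

Let x_gt0 : 0 < x.
Proof.
have /andP[e0 _] := eps01.
by rewrite divr_gt0 ?mulr_gt0// (lt_le_trans _ c_ge1).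
Qed.

Lemma decay_le_expR l : decay c eps ^+ l <= expR (- (l%:R * x)).
Proof.
have /andP[e0 e1] := eps01.
have d0 : 0 <= decay c eps.
  rewrite subr_ge0 ler_pdivrMr ?mulr_gt0 ?(lt_le_trans _ c_ge1)// mul1r.
  have : eps * eps <= 1 * 1 by rewrite ler_pM ?ltW.
  by move: c_ge1; lra.
rewrite -mulrN expRM_natl lerXn2r ?nnegrE ?expR_ge0//.
exact: expR_ge1Dx.
Qed.

(** By minimality [L - 1] is too short, so the exponential bound on [decay] gives
    [(L - 1) x < ln (1 / delta)]. *)
Lemma block_length_exists : exists L, [/\ (0 < L)%N, decay c eps ^+ L <= delta,
  forall l, (l < L)%N -> delta < decay c eps ^+ l &
  L%:R <= 1 + 10%:R * (eps ^- 2 * c * ln delta^-1)].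
Proof.
have /andP[e0 e1] := eps01; have /andP[d0 d1] := delta01.
have ex : exists l, decay c eps ^+ l <= delta.
  exists (Num.truncn (ln delta^-1 / x)).+1; apply: le_trans (decay_le_expR _) _.
  rewrite -[leRHS]lnK ?posrE// ler_expR -[ln delta]opprK -lnV ?posrE// lerN2.
  by rewrite -ler_pdivrMr// ltW// truncnS_gt.
exists (ex_minn ex); case: ex_minnP => L decL Lmin.
have L0 : (0 < L)%N by case: L decL {Lmin} => //; rewrite expr0 leNgt d1.
have minL l : (l < L)%N -> delta < decay c eps ^+ l.
  by move=> lL; rewrite ltNge; apply/negP => /Lmin; rewrite leqNgt lL.
split=> //.
have := lt_le_trans (minL L.-1 _) (decay_le_expR _); rewrite prednK// => /(_ (leqnn _)).
rewrite -{1}[delta]lnK ?posrE// ltr_expR ltrNr -lnV ?posrE// -ltr_pdivlMr//.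
have -> : ln delta^-1 / x = 10%:R * (eps ^- 2 * c * ln delta^-1).
  by rewrite /x; field; rewrite !gt_eqF// (lt_le_trans _ c_ge1).
by rewrite -{2}(prednK L0) -natr1; lra.
Qed.

End BlockLength.

(** * Numerical bounds on logarithms *)

Section Logarithms.
Variable R : realType.

Lemma expR1_le3 : expR 1 <= 3%:R :> R.
Proof.
(* An eighth is fine enough: it gives [e <= (8/7)^8], which is below 3. *)
have h : 7%:R / 8%:R <= expR (- 8%:R^-1) :> R.
  by apply: le_trans (expR_ge1Dx _); lra.
have e8 : expR (8%:R^-1) <= 8%:R / 7%:R :> R.
  by rewrite -[expR _]invrK -expRN invf_ple ?posrE ?expR_gt0 ?divr_gt0// invf_div.
have {1}-> : 1 = 8%:R * 8%:R^-1 :> R by rewrite divff ?pnatr_eq0.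
rewrite expRM_natl; apply: (@le_trans _ _ ((8%:R / 7%:R) ^+ 8)).
  by rewrite lerXn2r// nnegrE ?expR_ge0 ?divr_ge0.
by rewrite !exprS expr0; lra.
Qed.

Lemma ln_ge_nat (k : nat) (y : R) : 3%:R ^+ k <= y -> k%:R <= ln y.
Proof.
move=> h; have y0 : 0 < y by rewrite (lt_le_trans _ h)// exprn_gt0.
rewrite -ler_expR lnK ?posrE//; apply: le_trans h.
by rewrite -[k%:R]mulr1 expRM_natl lerXn2r// ?nnegrE ?expR_ge0// expR1_le3.
Qed.

(** As [n / delta >= 10 >= 3^2], its logarithm is at least 2, so the argument of the outer logarithm
    is at least [2 ln 2 = ln 4 >= 1]. *)
Lemma ln_slack_ge0 (n delta : R) : 2%:R <= n -> 0 < delta < 5%:R^-1 ->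
  1 <= ln delta^-1 /\ 0 <= ln (ln (ln (n / delta)) + ln n).
Proof.
move=> n2 /andP[d0 d5].
have dV : 5%:R < delta^-1 by rewrite -[5%:R]invrK ltf_pV2 ?posrE ?invr_gt0.
split; first by apply: (@ln_ge_nat 1); rewrite expr1; lra.
apply: ln_ge0.
have h2 : 2%:R <= ln (n / delta).
  apply: (@ln_ge_nat 2); apply: (@le_trans _ _ (2%:R * 5%:R)).
    by rewrite !exprS expr0; lra.
  by rewrite ler_pM// ltW.
apply: (@le_trans _ _ (ln 2%:R + ln 2%:R)).
  rewrite -lnM ?posrE//; apply: (@ln_ge_nat 1); rewrite expr1; lra.
by rewrite lerD// ler_ln ?posrE// (lt_le_trans _ h2, lt_le_trans _ n2).
Qed.

End Logarithms.

Lemma geometric_sum_le (R : realFieldType) (delta : R) K :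
  0 <= delta <= 5%:R^-1 ->
  \sum_(k <- iota 1 K) delta ^+ k <= 5%:R / 4%:R * delta.
Proof.
move=> /andP[d0 d5].
(* Carrying a bound on the tail of the series makes the induction go through. *)
suff h : \sum_(k <- iota 1 K) delta ^+ k + 5%:R / 4%:R * delta ^+ K.+1 <=
    5%:R / 4%:R * delta.
  by apply: le_trans h; rewrite lerDl mulr_ge0 ?divr_ge0 ?exprn_ge0.
elim: K => [|K IH]; first by rewrite big_nil add0r expr1.
rewrite -[in iota 1 _](addn1 K) iotaD big_cat big_seq1 add1n /=; apply: le_trans IH.
rewrite -addrA lerD2l [delta ^+ K.+2]exprS.
have : delta * delta ^+ K.+1 <= 5%:R^-1 * delta ^+ K.+1.
  by rewrite ler_wpM2r// exprn_ge0.
lra.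
Qed.

(** * Failure events over all rounds *)

Section Failure.
Variables (R : realType) (V : finType) (G : sdm R V) (tau s : nat).
Variables (c eps delta : R).
Hypothesis s_gt0 : (0 < s)%N.
Hypothesis c_ge1 : 1 <= c.
Hypothesis eps_gt0 : 0 < eps.
Hypothesis eps_lt : 5%:R * eps < 1.
Hypothesis delta_gt0 : 0 < delta.
Hypothesis delta_le : delta <= 5%:R^-1.
Hypothesis variance_le : variance_bounded G tau c.
Variables (L K r N : nat) (S : {set V}).
Hypothesis L_gt0 : (0 < L)%N.
Hypothesis decayL : decay c eps ^+ L <= delta.
Hypothesis S_le : (#|S| <= s)%N.
Hypothesis S_opt : influence G tau S = opt G tau s.
Hypothesis K_gt0 : (0 < K)%N.
Hypothesis K_large : (r <= K * L)%N.
Hypothesis K_draws : (K.*2.+1 * L <= N)%N.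
Local Notation H := (util G).
Local Notation E := (Ex (pmf G)).
Local Notation possible := (all (fun phi => pmf G phi != 0)).
Local Notation unif x := (`[< uniform_approx G tau eps s (avg_oracle G tau x) >]).
Hypothesis sub : forall x, possible x -> submodular (avg_oracle G tau x).
Hypothesis uniform_prob : forall l, (r <= l)%N ->
  1 - delta <= E l (fun x => (unif x)%:R).

Local Notation base k w := (take (k * L) w).
Local Notation pool k w := (take (k * L) (drop (k * L) w)).

(** Soundness is wanted in every round up to [K], acceptance only in round [K]. Intersecting the
    last event with uniformity lets [reject_prob] be applied base by base, without conditional
    probabilities. *)
Definition failures : seq (seq (simulation V) -> bool) :=
  [seq (fun w => unsound G tau s c eps (delta ^+ k) (base k w) (pool k w)) |
     k <- iota 1 K] ++
  [seq (fun w => (estimate H tau (base k w) S < (1 - eps) * opt G tau s)%R) |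
     k <- iota 1 K] ++
  [:: (fun w => ~~ unif (base K w));
      (fun w => unif (base K w) && ~~ round_ok H s tau c eps delta w L K)].

Lemma round_draws k : (k <= K)%N -> (k * L + k * L <= N)%N.
Proof.
move=> kK; apply: leq_trans K_draws.
rewrite -mulnDl addnn leq_mul2r orbC.
by rewrite (leq_trans (_ : _ <= K.*2)%N) ?leq_double.
Qed.

Lemma decay_round k : decay c eps ^+ (k * L) <= delta ^+ k.
Proof.
rewrite mulnC exprM lerXn2r// nnegrE; last exact: ltW.
by rewrite exprn_ge0// ltW// (decay_gt0 c_ge1).
Qed.

Lemma failure_prob : E N (fun w => (has (fun A => A w) failures)%:R) <= 5%:R * delta.
Proof.
have p0 := pmf_ge0 G; have p1 := pmf_sum1 G.
have d01 : 0 <= delta <= 5%:R^-1 by rewrite ltW.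
have d1 : delta <= 1 by move: delta_le; lra.
apply: le_trans (Ex_union p0 p1 _ _) _.
rewrite !big_cat !big_map big_cons big_seq1 /=.
have geo := geometric_sum_le K d01.
have h1 : \sum_(k <- iota 1 K) E N (fun w =>
    (unsound G tau s c eps (delta ^+ k) (base k w) (pool k w))%:R) <=
    \sum_(k <- iota 1 K) delta ^+ k.
  rewrite big_seq [leRHS]big_seq; apply: ler_sum => k.
  rewrite mem_iota add1n ltnS => /andP[k0 kK].
  rewrite (Ex_take2 p1 (fun x y => (unsound G tau s c eps (delta ^+ k) x y)%:R)
    (round_draws kK)).
  rewrite -[leRHS](Ex_const p1 (k * L)); apply: Ex_le => // x _ _.
  by apply: unsound_prob => //; rewrite exprn_ge0// ltW.
have h2 : \sum_(k <- iota 1 K) E N (fun w =>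
    (estimate H tau (base k w) S < (1 - eps) * opt G tau s)%R%:R) <=
    \sum_(k <- iota 1 K) delta ^+ k.
  rewrite big_seq [leRHS]big_seq; apply: ler_sum => k.
  rewrite mem_iota add1n ltnS => /andP[k0 kK].
  have kN : (k * L <= N)%N by rewrite (leq_trans _ (round_draws kK))// leq_addr.
  rewrite (Ex_take p1 (fun x => (estimate H tau x S < (1 - eps) * opt G tau s)%R%:R) kN).
  apply: le_trans (decay_round k); apply: lower_tail_prob => //.
  by rewrite muln_gt0 k0.
have KN : (K * L <= N)%N by rewrite (leq_trans _ (round_draws (leqnn _)))// leq_addr.
have h3 : E N (fun w => (~~ unif (base K w))%:R) <= delta.
  rewrite (Ex_take p1 (fun x => (~~ unif x)%:R) KN) (Ex_compl p1).
  by have := uniform_prob K_large; lra.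
have h4 : E N (fun w => (unif (base K w) && ~~ round_ok H s tau c eps delta w L K)%:R)
    <= delta.
  rewrite (Ex_take2 p1 (fun x y =>
    (unif x && ~~ accept_block H s tau c eps (delta ^+ K) x y)%:R)
    (round_draws (leqnn _))).
  rewrite -[leRHS](Ex_const p1 (K * L)); apply: Ex_le => // x sx px.
  apply: (@le_trans _ _ (delta ^+ K)); last first.
    by rewrite -[leRHS]expr1; apply: ler_wiXn2l => //; exact: ltW.
  have x0 : (0 < size x)%N by rewrite sx muln_gt0 K_gt0.
  case: asboolP => [u|_] /=.
    by apply: (reject_prob s_gt0) => //; exact: decay_round.
  by rewrite (Ex_const p1) exprn_ge0// ltW.
(* The four contributions add up to [(5/4 + 5/4 + 1 + 1) delta]. *)
by move: delta_gt0; lra.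
Qed.

Lemma no_failure w k :
  size w = N -> possible w -> ~~ has (fun A => A w) failures ->
  (k <= K)%N -> (0 < k)%N -> round_ok H s tau c eps delta w L k ->
  (1 - (1 - s%:R^-1) ^+ s) * (1 - 5%:R * eps) * opt G tau s <=
    influence G tau (greedy_set H s tau (base k w)).
Proof.
move=> sw pw nof kK k0 ok.
have kI : k \in iota 1 K by rewrite mem_iota k0 add1n ltnS.
have px : possible (base k w).
  by apply/allP => phi /mem_take /(allP pw).
have kN : (k * L <= N)%N by rewrite (leq_trans _ (round_draws kK))// leq_addr.
have x0 : (0 < size (base k w))%N by rewrite size_takel ?sw// muln_gt0 k0.
move: nof; rewrite /failures !has_cat !has_map !negb_or => /and3P[/hasPn h1 /hasPn h2 _].
have := h1 _ kI; have := h2 _ kI => /= low uns.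
apply: (sound_greedy_set s_gt0 eps_gt0 eps_lt px x0 (sub px) S_le).
  by rewrite leNgt.
move: uns; rewrite /unsound -/(round_ok H s tau c eps delta w L k) ok /=.
by rewrite negb_and -!leNgt.
Qed.

Lemma last_round_ok w : ~~ has (fun A => A w) failures ->
  round_ok H s tau c eps delta w L K.
Proof.
rewrite /failures 2!has_cat => /norP[_ /norP[_ /norP[h1 /norP[h2 _]]]].
by move: h2; rewrite negb_and (negbTE h1) negbK.
Qed.

End Failure.

(** * Trivial cases and the final assembly *)

Section Main.
Variables (R : realType) (V : finType) (G : sdm R V) (tau s : nat).

Lemma approx_ratio_bounds : (0 < s)%N -> 0 <= 1 - (1 - s%:R^-1 : R) ^+ s <= 1.
Proof.
move=> s0; have s1 : s%:R^-1 <= 1 :> R by rewrite invf_le1 ?ler1n// ltr0n.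
rewrite subr_ge0 exprn_ile1 ?gerBl ?subr_ge0 ?invr_ge0//=.
by rewrite exprn_ge0// subr_ge0.
Qed.

Lemma influence_setT : opt G tau s <= influence G tau setT.
Proof.
apply: bigmax_le => [|T _]; first exact: influence_ge0.
apply: ler_sum => phi _; have [->|px] := eqVneq (pmf G phi) 0; first by rewrite !mul0r.
by rewrite ler_wpM2l ?pmf_ge0//; apply: reward_mono; [exact: pmf_monotone px|rewrite subsetT].
Qed.

Lemma prob_ge0 l (A : seq (simulation V) -> Prop) :
  0 <= prob G (fun w : l.-tuple (simulation V) => A w).
Proof.
rewrite prob_Ex -[leLHS](Ex_const (pmf_sum1 G) l); by apply: (Ex_le (pmf_ge0 G)) => w _ _.
Qed.

Lemma prob_all l (A : seq (simulation V) -> Prop) :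
  (forall w, size w = l -> A w) ->
  1 <= prob G (fun w : l.-tuple (simulation V) => A w).
Proof.
move=> hA; rewrite prob_Ex -[leLHS](Ex_const (pmf_sum1 G) l).
by apply: (Ex_le (pmf_ge0 G)) => w sw _; rewrite asboolT//; apply: hA.
Qed.

End Main.

Theorem theorem7p2 (R : realType) :
  exists (prog : cmd) (a b : nat) (C : R), 0 < C /\
  forall (V : finType) (G : sdm R V) (tau s : nat) (c eps delta : R),
    (1 <= s)%N -> 1 <= c -> 0 < eps < 1 -> 0 < delta < 1 ->
    let time (m : nat) := (a * (#|V| + m + 1) ^ b)%N in
    let exec (m : nat) (w : m.-tuple (simulation V)) :=
      run (util G) w prog (initial V s tau c eps delta) (time m) in
    (forall (m : nat) (w : m.-tuple (simulation V)),
       starved w (exec m w) ||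
       halted (exec m w) && (#|output (exec m w)| <= s)%N) /\
    (variance_bounded G tau c ->
     forall r r0 : nat,
       (forall (l : nat) (w : l.-tuple (simulation V)),
          supported G w -> submodular (avg_oracle G tau w)) ->
       (forall l : nat, (r <= l)%N ->
          1 - delta <=
          prob G (fun w : l.-tuple (simulation V) =>
                    uniform_approx G tau eps s (avg_oracle G tau w))) ->
       (forall T : {set V},
          1 - delta <=
          prob G (fun w : r0.-tuple (simulation V) =>
                    approx_at G tau eps (avg_oracle G tau w) T)) ->
       let n : R := #|V|%:R in
       let N := Num.truncn
         (2 * (maxn r r0)%:R +
          C * (eps ^- 2 * c *
               Num.max 0
                 (ln delta^-1 + ln (ln (ln (n / delta)) + ln n)))) in
       1 - 5 * delta <=
       prob G (fun w : N.-tuple (simulation V) =>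
                 halted (exec N w) /\
                 (1 - (1 - s%:R^-1) ^+ s) * (1 - 5 * eps) * opt G tau s
                   <= influence G tau (output (exec N w)))).
Proof.
have [a [b cost_le]] := cost_poly main_cmd.
(* The constant is [3 (1 + 10)]: three blocks, each of length at most [1 + 10 X], where
   [X = eps^-2 c ln (1 / delta)] is at least 1 in the nontrivial case. *)
exists main_cmd, a, b, 33%:R; split; first by [].
move=> V G tau s c eps delta s1 c1 eps01 delta01 time exec.
have [L [L0 decL minL Lle]] := block_length_exists c1 eps01 delta01.
have /andP[e0 e1] := eps01; have /andP[d0 d1] := delta01.
pose ok w k := round_ok (util G) s tau c eps delta w L k.
pose rejected w k := forall k', (0 < k' < k)%N -> ~~ ok w k'.
pose greedy_out w k := greedy_set (util G) s tau (take (k * L) w).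
pose outcome (w : seq (simulation V)) :=
  run (util G) w main_cmd (initial V s tau c eps delta) (time (size w)).
have execP w :
    (starved w (outcome w) /\ (s < #|V|)%N /\ 5%:R * eps < 1 /\
       exists2 k, (size w < k.*2.+1 * L)%N & rejected w k) \/
    (halted (outcome w) /\
      [\/ (#|V| <= s)%N /\ output (outcome w) = setT,
        1 <= 5%:R * eps /\ output (outcome w) = set0 |
        [/\ (s < #|V|)%N, 5%:R * eps < 1 &
          exists k, [/\ (0 < k)%N, ok w k, rejected w k &
            output (outcome w) = greedy_out w k]]]).
  pose B := (s < #|V|)%N /\ 5%:R * eps < 1 /\
       exists2 k, (size w < k.*2.+1 * L)%N & rejected w k.
  pose Q (st : state R V) := 
      [\/ (#|V| <= s)%N /\ sreg st 0 = setT,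
        1 <= 5%:R * eps /\ sreg st 0 = set0 |
        [/\ (s < #|V|)%N, 5%:R * eps < 1 &
          exists k, [/\ (0 < k)%N, ok w k, rejected w k &
            sreg st 0 = greedy_out w k]]].
  have := @wp_run R V (util G) w B (#|V| + size w + 1) (time (size w)) main_cmd
    (initial V s tau c eps delta) Q.
  case.
  - by rewrite /time addn1.
  - apply: (wp_main _ _ L0 decL minL).
    + by rewrite -addnA leq_addr.
    + by rewrite addn1 leqW// leq_addl.
    + by move=> h1 h2 k h3 h4; split=> //; split=> //; exists k.
    + by move=> h st outE; constructor 1.
    + by move=> h st outE; constructor 2.
    + by move=> h1 h2 st k k0 okk rej outE; constructor 3; split=> //; exists k.
  - by move=> [hB hs]; left.
  - by right.
split=> [m w|vb r r0 sub unif _].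
- have := execP w; rewrite /outcome size_tuple -/(exec m w) => -[[-> //]|[-> h]].
  rewrite orbC /=; apply/orP; left.
  case: h => [[Vs ->]|[_ ->]|[_ _ [k [_ _ _ ->]]]].
  + by rewrite cardsT.
  + by rewrite cards0.
  + exact: card_greedy.
lazy zeta; set n : R := #|V|%:R; set N := Num.truncn _.
pose good w := halted (outcome w) /\
  (1 - (1 - s%:R^-1) ^+ s) * (1 - 5 * eps) * opt G tau s
     <= influence G tau (output (outcome w)).
have -> : prob G (fun w : N.-tuple (simulation V) => halted (exec N w) /\
    (1 - (1 - s%:R^-1) ^+ s) * (1 - 5 * eps) * opt G tau s
      <= influence G tau (output (exec N w))) =
    prob G (fun w : N.-tuple (simulation V) => good w).
  by congr prob; apply/funext => w; rewrite /good /outcome size_tuple.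
have /andP[K0 K1] := approx_ratio_bounds R s1.
have O0 := opt_ge0 G tau s.
have [d5|d5] := leP (5%:R^-1) delta.
  by apply: le_trans (prob_ge0 _ _ _); lra.
have d5' : 1 - 5%:R * delta <= 1 by lra.
have [Vs|sV] := leqP #|V| s.
  apply: le_trans d5' (prob_all _ _) => w sw.
  case: (execP w) => [[_ [h _]]|[hh h]]; first by move: h; rewrite ltnNge Vs.
  (* The alternatives of [execP] overlap, so a large [eps] is handled here as well; the ratio is
     then at most 0. *)
  have outT : output (outcome w) = setT \/ 1 <= 5%:R * eps.
    by case: h => [[_ ->]|[? _]|[h _ _]]; [left|right|move: h; rewrite ltnNge Vs].
  split=> //; case: outT => [->|he].
    apply: le_trans (influence_setT G tau s); rewrite -[leRHS]mul1r ler_wpM2r//.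
    have : (1 - (1 - s%:R^-1) ^+ s) * (5%:R * eps) >= 0 by rewrite mulr_ge0// mulr_ge0// ltW.
    lra.
  apply: le_trans (influence_ge0 _ _ _).
  by rewrite mulr_le0_ge0// mulr_ge0_le0//; lra.
have [he|he] := leP 1 (5%:R * eps).
  apply: le_trans d5' (prob_all _ _) => w sw.
  case: (execP w) => [[_ [_ [h _]]]|[hh h]]; first by move: h; rewrite ltNge he.
  split=> //; apply: le_trans (influence_ge0 _ _ _).
  by rewrite mulr_le0_ge0// mulr_ge0_le0//; lra.
have [S Ss IS] := opt_attained G tau s.
have n2 : 2%:R <= n by rewrite ler_nat (leq_ltn_trans s1).
have [ln1 ln2] := ln_slack_ge0 n2 (introT andP (conj d0 d5)).
have ec1 : 1 <= eps ^- 2 * c.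
  by rewrite -[1]mulr1 ler_pM// invf_ge1 ?exprn_gt0// exprn_ile1// ltW.
have NL : (2 * r + 3 * L <= N)%N.
  rewrite /N truncn_ge_nat; last first.
    rewrite addr_ge0//; first by rewrite mulr_ge0.
    by rewrite mulr_ge0// mulr_ge0 ?le_max ?lexx// (le_trans ler01 ec1).
  rewrite natrD !natrM lerD// ?ler_wpM2l// ?ler_nat ?leq_maxl//.
  set lnd := ln delta^-1 in Lle ln1 *.
  have : eps ^- 2 * c * lnd <= eps ^- 2 * c * Num.max 0 (lnd + ln (ln (ln (n / delta)) + ln n)).
    rewrite ler_wpM2l ?(le_trans ler01 ec1)// le_max; apply/orP; right.
    by rewrite lerDl.
  have : 1 <= eps ^- 2 * c * lnd by rewrite -[1]mulr1 ler_pM.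
  by move: Lle; lra.
have sub' x : all (fun phi => pmf G phi != 0) x -> submodular (avg_oracle G tau x).
  move=> px; apply: (sub _ (in_tuple x)) => i.
  by have /allP := px; apply; rewrite mem_tnth.
have unif' l : (r <= l)%N -> 1 - delta <= Ex (pmf G) l (fun x =>
    (`[< uniform_approx G tau eps s (avg_oracle G tau x) >])%:R).
  by move=> rl; rewrite -prob_Ex; apply: unif.
have [K [K_gt0 rK KN]] : exists K, [/\ (0 < K)%N, (r <= K * L)%N & (K.*2.+1 * L <= N)%N].
  (* This choice gives [(K - 1) L <= r < K L], hence [(2 K + 1) L <= 2 r + 3 L]. *)
  exists (r %/ L).+1; split=> //; first by rewrite ltnW// ltn_ceil.
  apply: leq_trans NL.
  by rewrite doubleS -addn3 mulnDl -mul2n -mulnA leq_add2r leq_mul2l leq_trunc_div orbT.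
have fail := failure_prob s1 c1 e0 he d0 (ltW d5) vb L0 decL IS K_gt0 rK KN unif'.
rewrite prob_Ex.
set Fs := failures _ _ _ _ _ _ _ _ _ in fail.
apply: (@le_trans _ _ (Ex (pmf G) N (fun w => (~~ has (fun A => A w) Fs)%:R))).
  by rewrite (Ex_compl (pmf_sum1 G)); lra.
apply: (Ex_le (pmf_ge0 G)) => w sw pw.
case: (boolP (has _ _)) => // nof; rewrite asboolT//.
have okK := last_round_ok nof.
(* Round [K] accepts, so the search never goes beyond it; starving earlier would contradict
   [(2 K + 1) L <= N]. *)
have before k : rejected w k -> (k <= K)%N.
  move=> rej; rewrite leqNgt; apply/negP => kK.
  by have := rej K; rewrite K_gt0 kK /ok okK => /(_ isT).
case: (execP w) => [[_ [_ [_ [k sk /before kK]]]]|[hh h]].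
  exfalso; move: sk; rewrite sw ltnNge => /negP; apply.
  apply: leq_trans KN.
  by rewrite leq_mul2r ltnS leq_double kK orbT.
split=> //; case: h => [[h _]|[h _]|[_ _ [k [k0 okk rej ->]]]].
- by move: sV; rewrite ltnNge h.
- by move: he; rewrite ltNge h.
- exact: (no_failure s1 e0 he L0 Ss KN sub' sw pw nof (before _ rej)).
Qed.
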